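(* Let $U=U_q(\mathfrak{sl}_2)$ with Casimir element $C$, comultiplication $\Delta$ and flipped universal $R$-matrix $\widetilde{\mathcal{R}}$. Set $C_1=C\otimes1\otimes1$, $C_2=1\otimes C\otimes1$, $C_3=1\otimes1\otimes C$, $C_{12}=\Delta(C)\otimes1$, $C_{23}=1\otimes\Delta(C)$, $C_{123}=(\Delta\otimes\mathrm{id})\Delta(C)$, $C_{13}=C_{(1)}\otimes1\otimes C_{(2)}$ (where $\Delta(C)=C_{(1)}\otimes C_{(2)}$ in Sweedler notation) and $C_{13}^{(0)}=\widetilde{\mathcal{R}}_{23}^{-1}\,C_{13}\,\widetilde{\mathcal{R}}_{23}$. Then, in $U^{\otimes3}$, $$\frac{1}{q-q^{-1}}[C_{12},C_{23}]_q=C_{13}^{(0)}+C_1C_3+C_2C_{123},$$ where $[A,B]_q=qAB-q^{-1}BA$.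
   Context: Let $q\in\mathbb{C}^*$ be not a root of unity (in particular $q\neq\pm1,\pm i$), with a fixed square root $q^{1/2}$. Write $[X]_q=\frac{q^X-q^{-X}}{q-q^{-1}}$, $[n]_q!=[n]_q[n-1]_q\cdots[1]_q$, $[0]_q!=1$. The algebra $U=U_q(\mathfrak{sl}_2)$ is the associative unital algebra over $\mathbb{C}$ generated by $E$, $F$ and the invertible element $q^{H}$ (with $q^{kH}=(q^H)^k$ for $k\in\mathbb{Z}$), with relations $q^HE=qEq^H$, $q^HF=q^{-1}Fq^H$, $[E,F]=[2H]_q=\frac{q^{2H}-q^{-2H}}{q-q^{-1}}$. The Casimir element, which is central, is $$C=-\frac{(q-q^{-1})^2}{q+q^{-1}}\left(FE+\frac{q\,q^{2H}+q^{-1}q^{-2H}}{(q-q^{-1})^2}\right).$$ The comultiplication is the algebra homomorphism $\Delta:U\to U\otimes U$ with $\Delta(E)=E\otimes q^{-H}+q^H\otimes E$, $\Delta(F)=F\otimes q^{-H}+q^H\otimes F$, $\Delta(q^H)=q^H\otimes q^H$; it is coassociative. The flip $\widetilde{\mathcal{R}}=\mathcal{R}_{21}$ of the universal $R$-matrix $\mathcal{R}$ is $$\widetilde{\mathcal{R}}=\sum_{n\ge0}\frac{(q-q^{-1})^n}{[n]_q!}q^{n(n-1)/2}(Fq^H\otimes q^{-H}E)^n\;q^{2(H\otimes H)},$$ and $\widetilde{\mathcal{R}}_{23}=1\otimes\widetilde{\mathcal{R}}$. Interpretation of the series: for $n\ge0$ let $V_n$ be the simple $U$-module of dimension $n+1$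 whose highest weight vector has $q^H$-eigenvalue $q^{n/2}$; put $\widehat{U^{\otimes k}}=\prod_{n_1,\dots,n_k\ge0}\mathrm{End}(V_{n_1}\otimes\cdots\otimes V_{n_k})$. Since $q$ is not a root of unity, $U^{\otimes k}$ embeds in $\widehat{U^{\otimes k}}$ and is identified with its image. The operator $q^{2(H\otimes H)}$ acts on a tensor product of weight vectors with $q^H$-eigenvalues $q^{m}$, $q^{m'}$ ($m,m'\in\frac12\mathbb{Z}$) as multiplication by $q^{2mm'}$, so $\widetilde{\mathcal{R}}$ is a well-defined invertible element of $\widehat{U^{\otimes 2}}$, and products with $\widetilde{\mathcal{R}}_{23}$ are taken in $\widehat{U^{\otimes 3}}$. *)

(* Defs.v *)
From HB Require Import structures.
From mathcomp Require Import all_boot all_order all_algebra.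
From mathcomp Require Import boolp classical_sets mxtens ring.

Set Implicit Arguments.
Unset Strict Implicit.
Unset Printing Implicit Defensive.

Import GRing.Theory.
Local Open Scope ring_scope.
Local Open Scope quotient_scope.

(* Algebras presented by generators and relations: formal expressions in the  *)
(* generators modulo the least congruence that contains the relations and     *)
(* satisfies the axioms of unital associative algebras.                       *)

Inductive term (K X : Type) : Type :=
  | TGen of X
  | TCst of K
  | TAdd of term K X & term K X
  | TMul of term K X & term K X.
Arguments TGen {K X}.
Arguments TCst {K X}.

HB.instance Definition _ (K X : Type) := gen_eqMixin (term K X).
HB.instance Definition _ (K X : Type) := gen_choiceMixin (term K X).

Section Presented.
Variables (K : fieldType) (X : Type) (rel : term K X -> term K X -> Prop).
Implicit Types (s t u : term K X) (a b c : K).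

Inductive pres_eq : term K X -> term K X -> Prop :=
  | pe_refl s : pres_eq s s
  | pe_sym s t : pres_eq s t -> pres_eq t s
  | pe_trans s t u : pres_eq s t -> pres_eq t u -> pres_eq s u
  | pe_add s s' t t' : pres_eq s s' -> pres_eq t t' ->
      pres_eq (TAdd s t) (TAdd s' t')
  | pe_mul s s' t t' : pres_eq s s' -> pres_eq t t' ->
      pres_eq (TMul s t) (TMul s' t')
  | pe_addA s t u : pres_eq (TAdd s (TAdd t u)) (TAdd (TAdd s t) u)
  | pe_addC s t : pres_eq (TAdd s t) (TAdd t s)
  | pe_add0 s : pres_eq (TAdd (TCst 0) s) s
  | pe_addN s : pres_eq (TAdd (TMul (TCst (-1)) s) s) (TCst 0)
  | pe_mulA s t u : pres_eq (TMul s (TMul t u)) (TMul (TMul s t) u)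
  | pe_mul1 s : pres_eq (TMul (TCst 1) s) s
  | pe_mulDl s t u : pres_eq (TMul (TAdd s t) u) (TAdd (TMul s u) (TMul t u))
  | pe_mulDr s t u : pres_eq (TMul s (TAdd t u)) (TAdd (TMul s t) (TMul s u))
  | pe_cstD a b : pres_eq (TCst (a + b)) (TAdd (TCst a) (TCst b))
  | pe_cstM a b : pres_eq (TCst (a * b)) (TMul (TCst a) (TCst b))
  | pe_cstC a s : pres_eq (TMul (TCst a) s) (TMul s (TCst a))
  | pe_rel s t : rel s t -> pres_eq s t.

Definition pres_eqb s t : bool := `[< pres_eq s t >].

Fact pres_eqb_refl : reflexive pres_eqb.
Proof. by move=> s; apply/asboolP; apply: pe_refl. Qed.
Fact pres_eqb_sym : symmetric pres_eqb.
Proof. by move=> s t; apply: asbool_equiv_eq; split; apply: pe_sym. Qed.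
Fact pres_eqb_trans : transitive pres_eqb.
Proof.
by move=> t s u /asboolP st /asboolP tu; apply/asboolP; apply: pe_trans tu.
Qed.
Canonical pres_equiv :=
  EquivRel pres_eqb pres_eqb_refl pres_eqb_sym pres_eqb_trans.

Definition presalg : Type := {eq_quot pres_equiv}.
HB.instance Definition _ := Choice.on presalg.
HB.instance Definition _ := EqQuotient.on presalg.

Definition pcls t : presalg := \pi t.
Definition pgen (x : X) : presalg := pcls (TGen x).

Lemma pclsP s t : pres_eq s t <-> pcls s = pcls t.
Proof.
split=> [st|/eqP]; first by apply/eqP; rewrite eqmodE; apply/asboolP.
by rewrite eqmodE => /asboolP.
Qed.

Lemma pclsK (x : presalg) : pcls (repr x) = x.
Proof. exact: reprK. Qed.

Lemma repr_pcls t : pres_eq (repr (pcls t)) t.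
Proof. by apply/pclsP; rewrite pclsK. Qed.

Let add (x y : presalg) := pcls (TAdd (repr x) (repr y)).
Let mul (x y : presalg) := pcls (TMul (repr x) (repr y)).
Let opp (x : presalg) := pcls (TMul (TCst (-1)) (repr x)).
Let scale c (x : presalg) := pcls (TMul (TCst c) (repr x)).

Let addE s t : add (pcls s) (pcls t) = pcls (TAdd s t).
Proof. by apply/pclsP; apply: pe_add; apply: repr_pcls. Qed.
Let mulE s t : mul (pcls s) (pcls t) = pcls (TMul s t).
Proof. by apply/pclsP; apply: pe_mul; apply: repr_pcls. Qed.
Let scaleE c s : scale c (pcls s) = pcls (TMul (TCst c) s).
Proof. by apply/pclsP; apply: pe_mul (repr_pcls _); apply: pe_refl. Qed.
Let oppE s : opp (pcls s) = pcls (TMul (TCst (-1)) s).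
Proof. exact: scaleE. Qed.

Let addA : associative add.
Proof.
move=> x y z; rewrite -(pclsK x) -(pclsK y) -(pclsK z) !addE.
exact/pclsP/pe_addA.
Qed.
Let addC : commutative add.
Proof.
by move=> x y; rewrite -(pclsK x) -(pclsK y) !addE; apply/pclsP/pe_addC.
Qed.
Let add0 : left_id (pcls (TCst 0)) add.
Proof. by move=> x; rewrite -(pclsK x) addE; apply/pclsP/pe_add0. Qed.
Let addN : left_inverse (pcls (TCst 0)) opp add.
Proof. by move=> x; rewrite -(pclsK x) oppE addE; apply/pclsP/pe_addN. Qed.
HB.instance Definition _ := GRing.isZmodule.Build presalg addA addC add0 addN.

Let mulA : associative mul.
Proof.
move=> x y z; rewrite -(pclsK x) -(pclsK y) -(pclsK z) !mulE.
exact/pclsP/pe_mulA.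
Qed.
Let mul1 : left_id (pcls (TCst 1)) mul.
Proof. by move=> x; rewrite -(pclsK x) mulE; apply/pclsP/pe_mul1. Qed.
Let mul_1 : right_id (pcls (TCst 1)) mul.
Proof.
move=> x; rewrite -(pclsK x) mulE; apply/pclsP.
exact: pe_trans (pe_sym (pe_cstC _ _)) (pe_mul1 _).
Qed.
Let mulDl : left_distributive mul +%R.
Proof.
move=> x y z; rewrite -(pclsK x) -(pclsK y) -(pclsK z) /+%R /= !(addE, mulE).
exact/pclsP/pe_mulDl.
Qed.
Let mulDr : right_distributive mul +%R.
Proof.
move=> x y z; rewrite -(pclsK x) -(pclsK y) -(pclsK z) /+%R /= !(addE, mulE).
exact/pclsP/pe_mulDr.
Qed.
HB.instance Definition _ :=
  GRing.Zmodule_isPzRing.Build presalg mulA mul1 mul_1 mulDl mulDr.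

Lemma pclsD s t : pcls (TAdd s t) = pcls s + pcls t.
Proof. by rewrite -addE. Qed.
Lemma pclsM s t : pcls (TMul s t) = pcls s * pcls t.
Proof. by rewrite -mulE. Qed.

Let scaleM c (x : presalg) : scale c x = pcls (TCst c) * x.
Proof. by rewrite -(pclsK x) scaleE pclsM. Qed.
Let cstM a b : pcls (TCst (a * b)) = pcls (TCst a) * pcls (TCst b).
Proof. by rewrite -pclsM; apply/pclsP/pe_cstM. Qed.
Let cstC a (x : presalg) : pcls (TCst a) * x = x * pcls (TCst a).
Proof. by rewrite -(pclsK x) -!pclsM; apply/pclsP/pe_cstC. Qed.

Let scaleA a b (x : presalg) : scale a (scale b x) = scale (a * b) x.
Proof. by rewrite !scaleM mulrA cstM. Qed.
Let scale1 : left_id 1 scale.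
Proof. by move=> x; rewrite scaleM mul1r. Qed.
Let scaleDr : right_distributive scale +%R.
Proof. by move=> c x y; rewrite !scaleM mulrDr. Qed.
Let scaleDl (x : presalg) : {morph scale^~ x : a b / a + b}.
Proof.
move=> a b; rewrite !scaleM -mulrDl -pclsD; congr (_ * _).
exact/pclsP/pe_cstD.
Qed.
HB.instance Definition _ :=
  GRing.Zmodule_isLmodule.Build K presalg scaleA scale1 scaleDr scaleDl.

Let scaleRE c (x : presalg) : c *: x = pcls (TCst c) * x.
Proof. exact: scaleM. Qed.

Lemma pres_scalerAl c (x y : presalg) : c *: (x * y) = (c *: x) * y.
Proof. by rewrite !scaleRE mulrA. Qed.
Lemma pres_scalerAr c (x y : presalg) : c *: (x * y) = x * (c *: y).
Proof. by rewrite !scaleRE mulrA cstC -mulrA. Qed.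

Lemma pclsC c : pcls (TCst c) = c *: (1 : presalg).
Proof. by rewrite scaleRE mulr1. Qed.

Lemma pcls_rel s t : rel s t -> pcls s = pcls t.
Proof. by move=> st; apply/pclsP/pe_rel. Qed.

Section Lift.
Variables (A : algType K) (f : X -> A).

Fixpoint teval t : A :=
  match t with
  | TGen x => f x
  | TCst c => c *: 1
  | TAdd s t => teval s + teval t
  | TMul s t => teval s * teval t
  end.

(* The algebra morphism sending each generator x to f x; it is one as soon    *)
(* as f satisfies the relations, see the lemmas below.                        *)
Definition plift (x : presalg) : A := teval (repr x).

Hypothesis f_rel : forall s t, rel s t -> teval s = teval t.

Lemma teval_eq s t : pres_eq s t -> teval s = teval t.
Proof.
elim=> //=.
- by move=> ? ? ? _ -> _ ->.
- by move=> ? ? ? ? _ -> _ ->.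
- by move=> ? ? ? ? _ -> _ ->.
- by move=> *; rewrite addrA.
- by move=> *; rewrite addrC.
- by move=> *; rewrite scale0r add0r.
- by move=> *; rewrite -scalerAl mul1r scaleN1r addNr scale0r.
- by move=> *; rewrite mulrA.
- by move=> *; rewrite scale1r mul1r.
- by move=> *; rewrite mulrDl.
- by move=> *; rewrite mulrDr.
- by move=> *; rewrite scalerDl.
- by move=> *; rewrite -scalerAl mul1r scalerA.
- by move=> *; rewrite -scalerAl -scalerAr mul1r mulr1.
Qed.

Lemma plift_pcls t : plift (pcls t) = teval t.
Proof. exact/teval_eq/repr_pcls. Qed.

Lemma plift_gen x : plift (pgen x) = f x.
Proof. exact: plift_pcls. Qed.

Lemma plift_monoid_morphism : monoid_morphism plift.
Proof.
split; first by rewrite -[1]scale1r -pclsC plift_pcls /= scale1r.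
by move=> x y; rewrite -(pclsK x) -(pclsK y) -pclsM !plift_pcls.
Qed.

Lemma plift_linear : linear plift.
Proof.
move=> c x y; rewrite -(pclsK x) -(pclsK y).
rewrite -[c *: pcls _]mul1r -pres_scalerAr pres_scalerAl -pclsC -pclsM -pclsD.
by rewrite !plift_pcls /= -scalerAl mul1r.
Qed.

End Lift.
End Presented.

(* Tensor products over a field: finite formal sums of pairs (a, b), written  *)
(* as lists, modulo bilinearity.                                              *)

Section TensorDef.
Variables (K : fieldType) (A B : lmodType K).
Implicit Types (s t u : seq (A * B)).

Inductive tens_eq : seq (A * B) -> seq (A * B) -> Prop :=
  | te_refl s : tens_eq s s
  | te_sym s t : tens_eq s t -> tens_eq t s
  | te_trans s t u : tens_eq s t -> tens_eq t u -> tens_eq s u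
  | te_cat s s' t t' : tens_eq s s' -> tens_eq t t' ->
      tens_eq (s ++ t) (s' ++ t')
  | te_catC s t : tens_eq (s ++ t) (t ++ s)
  | te_0l b : tens_eq [:: (0, b)] [::]
  | te_Dl a a' b : tens_eq [:: (a + a', b)] [:: (a, b); (a', b)]
  | te_Dr a b b' : tens_eq [:: (a, b + b')] [:: (a, b); (a, b')]
  | te_Z c a b : tens_eq [:: (c *: a, b)] [:: (a, c *: b)].

Definition tens_eqb s t : bool := `[< tens_eq s t >].

Fact tens_eqb_refl : reflexive tens_eqb.
Proof. by move=> s; apply/asboolP; apply: te_refl. Qed.
Fact tens_eqb_sym : symmetric tens_eqb.
Proof. by move=> s t; apply: asbool_equiv_eq; split; apply: te_sym. Qed.
Fact tens_eqb_trans : transitive tens_eqb.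
Proof.
by move=> t s u /asboolP st /asboolP tu; apply/asboolP; apply: te_trans tu.
Qed.
Canonical tens_equiv :=
  EquivRel tens_eqb tens_eqb_refl tens_eqb_sym tens_eqb_trans.

Definition tens : Type := {eq_quot tens_equiv}.
HB.instance Definition _ := Choice.on tens.
HB.instance Definition _ := EqQuotient.on tens.

Definition tcls s : tens := \pi s.
Definition tpure (a : A) (b : B) : tens := tcls [:: (a, b)].

Lemma tclsP s t : tens_eq s t <-> tcls s = tcls t.
Proof.
split=> [st|/eqP]; first by apply/eqP; rewrite eqmodE; apply/asboolP.
by rewrite eqmodE => /asboolP.
Qed.

Lemma tclsK (x : tens) : tcls (repr x) = x.
Proof. exact: reprK. Qed.

Lemma repr_tcls s : tens_eq (repr (tcls s)) s.
Proof. by apply/tclsP; rewrite tclsK. Qed.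

Let add (x y : tens) := tcls (repr x ++ repr y).
Let opps s := [seq (- ab.1, ab.2) | ab <- s].
Let opp (x : tens) := tcls (opps (repr x)).

Let addE s t : add (tcls s) (tcls t) = tcls (s ++ t).
Proof. by apply/tclsP; apply: te_cat; apply: repr_tcls. Qed.

Let opps_eq s t : tens_eq s t -> tens_eq (opps s) (opps t).
Proof.
elim=> {s t} /=.
- by move=> s; apply: te_refl.
- by move=> s t _; apply: te_sym.
- by move=> s t u _ st _; apply: te_trans.
- by move=> s s' t t' _ ss' _ tt'; rewrite /opps !map_cat; apply: te_cat.
- by move=> s t; rewrite /opps !map_cat; apply: te_catC.
- by move=> b; rewrite oppr0; apply: te_0l.
- by move=> a a' b; rewrite opprD; apply: te_Dl.
- by move=> a b b'; apply: te_Dr.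
- by move=> c a b; rewrite -scalerN; apply: te_Z.
Qed.
Let oppE s : opp (tcls s) = tcls (opps s).
Proof. by apply/tclsP/opps_eq/repr_tcls. Qed.

Let addA : associative add.
Proof.
by move=> x y z; rewrite -(tclsK x) -(tclsK y) -(tclsK z) !addE catA.
Qed.
Let addC : commutative add.
Proof.
by move=> x y; rewrite -(tclsK x) -(tclsK y) !addE; apply/tclsP/te_catC.
Qed.
Let add0 : left_id (tcls [::]) add.
Proof. by move=> x; rewrite -(tclsK x) addE. Qed.
Let addN : left_inverse (tcls [::]) opp add.
Proof.
move=> x; rewrite -(tclsK x) oppE addE; apply/tclsP.
elim: (repr x) => [|[a b] s IHs] /=; first exact: te_refl.
apply: te_trans (_ : tens_eq ([:: (- a, b)] ++ [:: (a, b)] ++ (opps s ++ s)) _).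
  rewrite -cat1s -(cat1s (a, b) s).
  apply: te_cat; first exact: te_refl.
  rewrite !catA; apply: te_cat; last exact: te_refl.
  exact: te_catC.
rewrite catA -[X in tens_eq _ X]cats0; apply: te_cat => //.
apply: te_trans (te_sym (te_Dl _ _ _)) _.
by rewrite addNr; apply: te_0l.
Qed.
HB.instance Definition _ := GRing.isZmodule.Build tens addA addC add0 addN.

Lemma tcls_cat s t : tcls (s ++ t) = tcls s + tcls t.
Proof. by rewrite -addE. Qed.

Lemma tclsE s : tcls s = \sum_(ab <- s) tpure ab.1 ab.2.
Proof.
elim: s => [|[a b] s IHs]; first by rewrite big_nil.
by rewrite big_cons -IHs -cat1s tcls_cat.
Qed.

Lemma tpureDl b : {morph tpure^~ b : a a' / a + a'}.
Proof. by move=> a a'; rewrite -tcls_cat; apply/tclsP/te_Dl. Qed.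
Lemma tpureDr a : {morph tpure a : b b' / b + b'}.
Proof. by move=> b b'; rewrite -tcls_cat; apply/tclsP/te_Dr. Qed.
Lemma tpureZ c a b : tpure (c *: a) b = tpure a (c *: b).
Proof. exact/tclsP/te_Z. Qed.

Lemma tens_ind (P : tens -> Prop) :
  P 0 -> (forall a b, P (tpure a b)) -> (forall x y, P x -> P y -> P (x + y)) ->
  forall x, P x.
Proof.
move=> P0 Pp PD x; rewrite -(tclsK x) tclsE.
by elim/big_rec: _ => // ab y _; apply: PD.
Qed.

(* The universal property of the tensor product: tlift f is the additive map  *)
(* with tlift f (tpure a b) = f a b, for f biadditive and K-balanced (in      *)
(* particular for f bilinear).                                                *)
Section Lift.
Variables (V : zmodType) (f : A -> B -> V).

Definition tlift (x : tens) : V := \sum_(ab <- repr x) f ab.1 ab.2.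

Definition balanced : Prop :=
  [/\ forall b, {morph f^~ b : a a' / a + a'},
      forall a, {morph f a : b b' / b + b'} &
      forall c a b, f (c *: a) b = f a (c *: b)].

Hypothesis f_bal : balanced.

Lemma tlift_tcls s : tlift (tcls s) = \sum_(ab <- s) f ab.1 ab.2.
Proof.
have [fDl fDr fZ] := f_bal.
have eqf u v : tens_eq u v ->
    \sum_(ab <- u) f ab.1 ab.2 = \sum_(ab <- v) f ab.1 ab.2; last exact: eqf (repr_tcls s).
elim=> {u v} //=.
- by move=> ? ? ? _ -> _ ->.
- by move=> ? ? ? ? _ IH1 _ IH2; rewrite !big_cat /= IH1 IH2.
- by move=> ? ?; rewrite !big_cat /= addrC.
- move=> b; rewrite big_nil big_seq1 /=.
  by apply: (addrI (f 0 b)); rewrite -fDl !addr0.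
- by move=> *; rewrite !big_cons !big_nil /= fDl !addr0.
- by move=> *; rewrite !big_cons !big_nil /= fDr !addr0.
- by move=> *; rewrite !big_seq1 /= fZ.
Qed.

Lemma tlift_pure a b : tlift (tpure a b) = f a b.
Proof. by rewrite tlift_tcls big_seq1. Qed.

Lemma tliftD : {morph tlift : x y / x + y}.
Proof.
move=> x y; rewrite -(tclsK x) -(tclsK y) -tcls_cat.
by rewrite !tlift_tcls big_cat.
Qed.

Lemma tlift0 : tlift 0 = 0.
Proof. by apply: (addrI (tlift 0)); rewrite -tliftD !addr0. Qed.

End Lift.

Let scale c : tens -> tens := tlift (fun a b => tpure (c *: a) b).

Let scale_bal c : balanced (fun a b => tpure (c *: a) b).
Proof.
split=> [b a a'|a b b'|d a b] /=; first by rewrite scalerDr tpureDl.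
  by rewrite tpureDr.
by rewrite scalerA mulrC -scalerA tpureZ.
Qed.
Let scale_pure c a b : scale c (tpure a b) = tpure (c *: a) b.
Proof. by rewrite /scale tlift_pure //; apply: scale_bal. Qed.
Let scaleD c : {morph scale c : x y / x + y}.
Proof. exact/tliftD/scale_bal. Qed.
Let scale0 c : scale c 0 = 0.
Proof. exact/tlift0/scale_bal. Qed.

Let scaleA c d x : scale c (scale d x) = scale (c * d) x.
Proof.
elim/tens_ind: x => [|a b|x y IHx IHy]; first by rewrite !scale0.
  by rewrite !scale_pure scalerA.
by rewrite !scaleD IHx IHy.
Qed.
Let scale1 : left_id 1 scale.
Proof.
elim/tens_ind=> [|a b|x y IHx IHy]; first by rewrite scale0.
  by rewrite scale_pure scale1r.
by rewrite scaleD IHx IHy.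
Qed.
Let scaleDl x : {morph scale^~ x : c d / c + d}.
Proof.
move=> c d; elim/tens_ind: x => [|a b|x y IHx IHy]; first by rewrite !scale0 addr0.
  by rewrite !scale_pure scalerDl tpureDl.
by rewrite !scaleD IHx IHy addrACA.
Qed.
HB.instance Definition _ :=
  GRing.Zmodule_isLmodule.Build K tens scaleA scale1 scaleD scaleDl.

Lemma tpureZl c a b : tpure (c *: a) b = c *: tpure a b.
Proof. exact/esym/scale_pure. Qed.
Lemma tpureZr c a b : tpure a (c *: b) = c *: tpure a b.
Proof. by rewrite -tpureZ tpureZl. Qed.

End TensorDef.

Notation "A ⊗ B" := (tens A%type B%type) (at level 40, left associativity) : type_scope.
Notation "a ⊗ b" := (tpure a b) (at level 40, left associativity) : ring_scope.

Section TensorLinear.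
Variables (K : fieldType) (A B V : lmodType K) (f : A -> B -> V).
Hypotheses (fl : forall b, linear (f^~ b)) (fr : forall a, linear (f a)).

Lemma bilinear_balanced : balanced f.
Proof.
have f0l b : f 0 b = 0.
  apply: (addrI (f 0 b)); have := fl b 1 0 0.
  by rewrite !scale1r !addr0 => {1}<-.
have f0r a : f a 0 = 0.
  apply: (addrI (f a 0)); have := fr a 1 0 0.
  by rewrite !scale1r !addr0 => {1}<-.
split=> [b a a'|a b b'|c a b].
- by have := fl b 1 a a'; rewrite !scale1r.
- by have := fr a 1 b b'; rewrite !scale1r.
- have := fl b c a 0; have := fr a c b 0.
  by rewrite !addr0 f0l f0r !addr0 => -> ->.
Qed.

Lemma tlift_linear : linear (tlift f).
Proof.
have f_bal := bilinear_balanced; have [fDl _ _] := f_bal.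
have f0l b : f 0 b = 0 by apply: (addrI (f 0 b)); rewrite -fDl !addr0.
move=> c x y; rewrite tliftD //; congr (_ + _).
elim/tens_ind: x => [|a b|x1 x2 IH1 IH2].
- by rewrite scaler0 tlift0 // scaler0.
- rewrite -tpureZl !tlift_pure //; have := fl b c a 0.
  by rewrite !addr0 f0l addr0.
- by rewrite scalerDr !tliftD // IH1 IH2 scalerDr.
Qed.

End TensorLinear.

(* An algebra over a field has a linear form with value 1 at 1; this is used  *)
(* only to see that a tensor product of nonzero algebras is nonzero.          *)
Section LinearForm.
Variables (K : fieldType) (A : lmodType K) (e : A).
Hypothesis e_neq0 : e <> 0.
Local Open Scope classical_set_scope.

Let sub (W : set A) : Prop :=
  (forall c x y, W x -> W y -> W (c *: x + y)) /\ ~ W e.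

Let maximal : exists W : set A, [/\ sub W, W 0 &
  forall W', sub W' -> W `<=` W' -> W' `<=` W].
Proof.
have [F subF Ftot|W [[WD We] Wmax]] := @Zorn_bigcup A sub.
  split=> [c x y [X FX Xx] [Y FY Yy]|[X FX]]; last by have [] := subF _ FX.
  have [XY|YX] := Ftot _ _ FX FY.
    by exists Y => //; have [YD _] := subF _ FY; apply: YD (XY _ Xx) Yy.
  by exists X => //; have [XD _] := subF _ FX; apply: XD Xx (YX _ Yy).
have Wle W' : sub W' -> W `<=` W' -> W' `<=` W.
  move=> sW' WW'; have [//|nW'W] := pselect (W' `<=` W).
  by case: (Wmax W').
exists W; split=> //; have [//|nW0] := pselect (W 0).
have [W00|[x Wx]] : W = set0 \/ exists x, W x.
  have [ex|nex] := pselect (exists x, W x); [by right|left].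
  by apply/seteqP; split=> // x Wx; case: nex; exists x.
- suff /(_ 0 erefl) : [set 0] `<=` W by [].
  apply: Wle; last by rewrite W00.
  split=> [c x y -> ->|/= e0]; last exact: e_neq0.
  by rewrite /= scaler0 addr0.
- by have := WD (-1) x x Wx Wx; rewrite scaleN1r addNr.
Qed.

Lemma linear_form1 : exists phi : A -> K,
  [/\ forall c x y, phi (c *: x + y) = c * phi x + phi y & phi e = 1].
Proof.
have [W [[WD We] W0 Wmax]] := maximal.
have WZ c x : W x -> W (c *: x).
  by move=> Wx; rewrite -[_ *: _]addr0; apply: WD.
have decomp a : exists c, W (a - c *: e).
  have [Wa|nWa] := pselect (W a); first by exists 0; rewrite scale0r subr0.
  pose W' x := exists c, W (x - c *: a).
  have WW' x : W x -> W' x by move=> Wx; exists 0; rewrite scale0r subr0.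
  have W'a : W' a by exists 1; rewrite scale1r subrr.
  have [[c Wc]|nW'e] := pselect (W' e); last first.
    case: nWa; apply: Wmax W'a => //; split=> // c x y [d Wd] [d' Wd'].
    exists (c * d + d'); have := WD c _ _ Wd Wd'.
    by rewrite scalerBr scalerA scalerDl opprD addrACA.
  have c_neq0 : c != 0.
    by apply: contra_notN We => /eqP c0; move: Wc; rewrite c0 scale0r subr0.
  exists c^-1; have := WZ (- c^-1) _ Wc.
  by rewrite scalerBr scalerA mulNr mulVf // !scaleNr scale1r opprK addrC.
have [phi Wphi] := choice decomp.
have uniq c d a : W (a - c *: e) -> W (a - d *: e) -> c = d.
  move=> Wc Wd; apply/eqP; rewrite -subr_eq0; apply: contra_notT We => cd.
  have := WZ (- (c - d)^-1) _ (WD (-1) _ _ Wd Wc).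
  rewrite scaleN1r opprB addrC addrA subrK addrC -[X in _ *: X]opprB -scalerBl.
  by rewrite scalerN scaleNr opprK scalerA mulVf // scale1r.
exists phi; split=> [c x y|].
- apply: (uniq _ _ (c *: x + y)) => //.
  have := WD c _ _ (Wphi x) (Wphi y).
  by rewrite scalerBr scalerA scalerDl opprD addrACA.
- by apply: (uniq _ _ e) => //; rewrite scale1r subrr.
Qed.

End LinearForm.

Section TensorAlgebra.
Variables (K : fieldType) (A B : algType K).
Local Notation T := (tens A B).
Implicit Types x y z : T.

Let mulp (a : A) (b : B) : T -> T := tlift (fun c d => (a * c) ⊗ (b * d)).
Let mul x y : T := tlift (fun a b => mulp a b y) x.

Let mulp_lin a b :
  (forall d, linear (fun c => (a * c) ⊗ (b * d) : T)) /\
  (forall c, linear (fun d => (a * c) ⊗ (b * d) : T)).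
Proof.
by split=> [d|c] k u v; rewrite mulrDr -scalerAr ?(tpureDl, tpureDr, tpureZl, tpureZr).
Qed.
Let mulp_bal a b : balanced (fun c d => (a * c) ⊗ (b * d) : T).
Proof. by case: (mulp_lin a b) => l r; apply: bilinear_balanced. Qed.

Let mulp_pure a b c d : mulp a b (c ⊗ d) = (a * c) ⊗ (b * d).
Proof. by rewrite /mulp tlift_pure //; apply: mulp_bal. Qed.
Let mulpD a b : {morph mulp a b : x y / x + y}.
Proof. exact/tliftD/mulp_bal. Qed.
Let mulp0 a b : mulp a b 0 = 0.
Proof. exact/tlift0/mulp_bal. Qed.

Let mulpl_lin y :
  (forall b, linear (fun a => mulp a b y)) /\
  (forall a, linear (fun b => mulp a b y)).
Proof.
split=> [b|a] k u v; elim/tens_ind: y => [|c d|y z IHy IHz].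
- by rewrite !mulp0 scaler0 addr0.
- by rewrite !mulp_pure mulrDl -scalerAl tpureDl tpureZl.
- by rewrite !mulpD IHy IHz scalerDr addrACA.
- by rewrite !mulp0 scaler0 addr0.
- by rewrite !mulp_pure mulrDl -scalerAl tpureDr tpureZr.
- by rewrite !mulpD IHy IHz scalerDr addrACA.
Qed.
Let mul_bal y : balanced (fun a b => mulp a b y).
Proof. by case: (mulpl_lin y) => l r; apply: bilinear_balanced. Qed.

Let mul_pure a b c d : mul (a ⊗ b) (c ⊗ d) = (a * c) ⊗ (b * d).
Proof. by rewrite /mul tlift_pure ?mulp_pure //; apply: mul_bal. Qed.
Let mulDl : left_distributive mul +%R.
Proof. by move=> x y z; apply/tliftD/mul_bal. Qed.
Let tmul0l y : mul 0 y = 0.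
Proof. exact/tlift0/mul_bal. Qed.
Let mulDr : right_distributive mul +%R.
Proof.
move=> x y z; elim/tens_ind: x => [|a b|x1 x2 IH1 IH2].
- by rewrite !tmul0l addr0.
- by rewrite /mul !tlift_pure ?mulpD //; apply: mul_bal.
- by rewrite !mulDl IH1 IH2 addrACA.
Qed.
Let tmul0r x : mul x 0 = 0.
Proof. by apply: (addrI (mul x 0)); rewrite -mulDr !addr0. Qed.

Let mulA : associative mul.
Proof.
move=> x y z.
elim/tens_ind: x => [|a b|x1 x2 IH1 IH2]; first by rewrite !tmul0l.
- elim/tens_ind: y => [|c d|y1 y2 IH1 IH2]; first by rewrite !(tmul0l, tmul0r).
  + elim/tens_ind: z => [|u v|z1 z2 IH1 IH2]; first by rewrite !tmul0r.
    * by rewrite !mul_pure !mulrA.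
    * by rewrite !mulDr IH1 IH2.
  + by rewrite !(mulDl, mulDr) IH1 IH2.
- by rewrite !mulDl IH1 IH2.
Qed.
Let mul1 : left_id (1 ⊗ 1) mul.
Proof.
elim/tens_ind=> [|a b|x y IHx IHy]; first by rewrite tmul0r.
- by rewrite mul_pure !mul1r.
- by rewrite mulDr IHx IHy.
Qed.
Let mul_1 : right_id (1 ⊗ 1) mul.
Proof.
elim/tens_ind=> [|a b|x y IHx IHy]; first by rewrite tmul0l.
- by rewrite mul_pure !mulr1.
- by rewrite mulDl IHx IHy.
Qed.
HB.instance Definition _ :=
  GRing.Zmodule_isPzRing.Build T mulA mul1 mul_1 mulDl mulDr.

Lemma tpureM (a c : A) (b d : B) : (a ⊗ b) * (c ⊗ d) = (a * c) ⊗ (b * d) :> T.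
Proof. exact: mul_pure. Qed.

Lemma tpure1 : 1 ⊗ 1 = 1 :> T.
Proof. by []. Qed.

Let one_neq0 : 1 != 0 :> T.
Proof.
have [phi [phiL phi1]] := linear_form1 (elimN eqP (oner_neq0 A)).
have [psi [psiL psi1]] := linear_form1 (elimN eqP (oner_neq0 B)).
have bal : @balanced K A B K^o (fun a b => phi a * psi b).
  apply: bilinear_balanced => [b|a] c u v /=.
    by rewrite phiL mulrDl -mulrA.
  by rewrite psiL mulrDr mulrCA.
apply/eqP => T0; have := tlift_pure bal 1 1.
rewrite tpure1 T0 tlift0 // phi1 psi1 mulr1 => /esym/eqP.
by rewrite oner_eq0.
Qed.
HB.instance Definition _ := GRing.PzSemiRing_isNonZero.Build T one_neq0.

Let scaleAl c x y : c *: (x * y) = (c *: x) * y.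
Proof.
elim/tens_ind: x => [|a b|x1 x2 IH1 IH2]; first by rewrite scaler0 !mul0r scaler0.
- elim/tens_ind: y => [|u v|y1 y2 IH1 IH2]; first by rewrite !mulr0 scaler0.
  + by rewrite -tpureZl !tpureM -tpureZl scalerAl.
  + by rewrite !mulrDr scalerDr IH1 IH2.
- by rewrite scalerDr !mulrDl scalerDr IH1 IH2.
Qed.
HB.instance Definition _ := GRing.LSemiModule_isLSemiAlgebra.Build K T scaleAl.

Let scaleAr c x y : c *: (x * y) = x * (c *: y).
Proof.
elim/tens_ind: x => [|a b|x1 x2 IH1 IH2]; first by rewrite !mul0r scaler0.
- elim/tens_ind: y => [|u v|y1 y2 IH1 IH2]; first by rewrite scaler0 !mulr0 scaler0.
  + by rewrite -tpureZr !tpureM -tpureZr scalerAr.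
  + by rewrite mulrDr !scalerDr mulrDr IH1 IH2.
- by rewrite !mulrDl scalerDr IH1 IH2.
Qed.
HB.instance Definition _ := GRing.LSemiAlgebra_isSemiAlgebra.Build K T scaleAr.

End TensorAlgebra.

Definition tmap (K : fieldType) (A B A' B' : lmodType K)
    (f : A -> A') (g : B -> B') : A ⊗ B -> A' ⊗ B' :=
  tlift (fun a b => f a ⊗ g b).

(* The associator (a ⊗ b) ⊗ c |-> a ⊗ (b ⊗ c). *)
Definition tassoc (K : fieldType) (A B C : lmodType K) :
    (A ⊗ B) ⊗ C -> A ⊗ (B ⊗ C) :=
  tlift (fun x c => tmap id (fun b => b ⊗ c) x).

Section TensorMaps.
Variables (K : fieldType) (A B C A' B' : lmodType K).
Variables (f : A -> A') (g : B -> B').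
Hypotheses (fL : linear f) (gL : linear g).

Let tmap_lin :
  (forall b, linear (fun a => f a ⊗ g b)) /\
  (forall a, linear (fun b => f a ⊗ g b)).
Proof.
by split=> [b|a] c u v /=; rewrite ?(fL, gL) ?tpureDl ?tpureDr ?tpureZl ?tpureZr.
Qed.

Lemma tmap_pure a b : tmap f g (a ⊗ b) = f a ⊗ g b.
Proof.
by have [l r] := tmap_lin; rewrite /tmap tlift_pure //; apply: bilinear_balanced.
Qed.

Lemma tmap_linear : linear (tmap f g).
Proof. by have [l r] := tmap_lin; apply: tlift_linear. Qed.

End TensorMaps.

Section TensorAssoc.
Variables (K : fieldType) (A B C : lmodType K).

Let rL (c : C) : linear (fun b : B => b ⊗ c).
Proof. by move=> k u v; rewrite tpureDl tpureZl. Qed.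

Let tassoc_lin :
  (forall c : C, linear (fun x : A ⊗ B => tmap id (fun b => b ⊗ c) x)) /\
  (forall x : A ⊗ B, linear (fun c : C => tmap id (fun b => b ⊗ c) x)).
Proof.
split=> [c|x] k u v; first exact: tmap_linear.
pose F c : A ⊗ B -> A ⊗ (B ⊗ C) := tmap id (fun b => b ⊗ c).
have FL c : linear (F c) by apply: tmap_linear.
have tD c : {morph F c : x y / x + y}.
  by move=> y z; have := FL c 1 y z; rewrite !scale1r.
have t0 c : F c 0 = 0 by apply: (addrI (F c 0)); rewrite -tD !addr0.
have tp c a b : F c (a ⊗ b) = a ⊗ (b ⊗ c) by rewrite /F tmap_pure.
rewrite -[LHS]/(F _ x) -[tmap _ _ x in RHS]/(F u x) -[X in _ = _ + X]/(F v x).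
elim/tens_ind: x => [|a b|x y IHx IHy]; first by rewrite !t0 scaler0 addr0.
- by rewrite !tp tpureDr tpureZr tpureDr tpureZr.
- by rewrite !tD IHx IHy scalerDr addrACA.
Qed.

Lemma tassoc_pure (a : A) (b : B) (c : C) : tassoc ((a ⊗ b) ⊗ c) = a ⊗ (b ⊗ c).
Proof.
have [l r] := tassoc_lin; rewrite /tassoc tlift_pure ?tmap_pure //.
exact: bilinear_balanced.
Qed.

Lemma tassoc_linear : linear (@tassoc K A B C).
Proof. by have [l r] := tassoc_lin; apply: tlift_linear. Qed.

End TensorAssoc.

Definition prodring (I : Type) (A : I -> pzRingType) : Type := forall i, A i.

Section ProdRing.
Variables (I : Type) (A : I -> pzRingType).
Local Notation P := (prodring A).
Implicit Types x y z : P.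

HB.instance Definition _ := gen_eqMixin P.
HB.instance Definition _ := gen_choiceMixin P.

Let ext x y : (forall i, x i = y i) -> x = y.
Proof. exact: functional_extensionality_dep. Qed.

Let zero : P := fun i => 0.
Let opp x : P := fun i => - x i.
Let add x y : P := fun i => x i + y i.
Let one : P := fun i => 1.
Let mul x y : P := fun i => x i * y i.

Let addA : associative add.
Proof. by move=> x y z; apply: ext => i; apply: addrA. Qed.
Let addC : commutative add.
Proof. by move=> x y; apply: ext => i; apply: addrC. Qed.
Let add0 : left_id zero add.
Proof. by move=> x; apply: ext => i; apply: add0r. Qed.
Let addN : left_inverse zero opp add.
Proof. by move=> x; apply: ext => i; apply: addNr. Qed.
HB.instance Definition _ := GRing.isZmodule.Build P addA addC add0 addN.

Let mulA : associative mul.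
Proof. by move=> x y z; apply: ext => i; apply: mulrA. Qed.
Let mul1 : left_id one mul.
Proof. by move=> x; apply: ext => i; apply: mul1r. Qed.
Let mul_1 : right_id one mul.
Proof. by move=> x; apply: ext => i; apply: mulr1. Qed.
Let mulDl : left_distributive mul +%R.
Proof. by move=> x y z; apply: ext => i; apply: mulrDl. Qed.
Let mulDr : right_distributive mul +%R.
Proof. by move=> x y z; apply: ext => i; apply: mulrDr. Qed.
HB.instance Definition _ :=
  GRing.Zmodule_isPzRing.Build P mulA mul1 mul_1 mulDl mulDr.

Lemma prodringP x y : (forall i, x i = y i) <-> x = y.
Proof. by split=> [/ext|->]. Qed.
Lemma prodringD x y i : (x + y) i = x i + y i. Proof. by []. Qed.
Lemma prodringN x i : (- x) i = - x i. Proof. by []. Qed.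
Lemma prodringM x y i : (x * y) i = x i * y i. Proof. by []. Qed.
Lemma prodring0 i : (0 : P) i = 0. Proof. by []. Qed.
Lemma prodring1 i : (1 : P) i = 1. Proof. by []. Qed.

End ProdRing.

(* GK and GKV stand for q^H and its inverse q^(-H). *)
Variant Ugen := GE | GF | GK | GKV.

Section QuantumSl2.
Variables (K : fieldType) (q : K).

Definition qint (n : nat) : K := (q ^+ n - q ^- n) / (q - q^-1).
Definition qfact (n : nat) : K := \prod_(1 <= i < n.+1) qint i.

Local Notation "s +t t" := (TAdd s t) (at level 50, left associativity).
Local Notation "s *t t" := (TMul s t) (at level 40, left associativity).
Local Notation c_ := (@TCst K Ugen).
Local Notation g_ := (@TGen K Ugen).

Inductive Urel : term K Ugen -> term K Ugen -> Prop :=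
  | Urel_KKV : Urel (g_ GK *t g_ GKV) (c_ 1)
  | Urel_KVK : Urel (g_ GKV *t g_ GK) (c_ 1)
  | Urel_KE : Urel (g_ GK *t g_ GE) (c_ q *t g_ GE *t g_ GK)
  | Urel_KF : Urel (g_ GK *t g_ GF) (c_ q^-1 *t g_ GF *t g_ GK)
  | Urel_EF : Urel
      (g_ GE *t g_ GF +t c_ (- 1) *t (g_ GF *t g_ GE))
      (c_ (q - q^-1)^-1 *t
        (g_ GK *t g_ GK +t c_ (- 1) *t (g_ GKV *t g_ GKV))).

Definition Uq : Type := presalg Urel.
HB.instance Definition _ := GRing.PzRing.on Uq.
HB.instance Definition _ := GRing.Lmodule.on Uq.

(* 1 != 0 in U, by the counit. *)
Fact Uq_one_neq0 : 1 != 0 :> Uq.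
Proof.
pose eps g : K^o := match g with GE | GF => 0 | GK | GKV => 1 end.
have eps_rel s t : Urel s t -> teval eps s = teval eps t.
  by case=> /=; rewrite ?(mulr0, mul0r, mulr1, scaler0, scale1r, scaleN1r,
    mulN1r, addrN, oppr0, addr0).
have [] := plift_monoid_morphism eps_rel => eps1 _; have := plift_linear eps_rel.
move=> epsL; apply/eqP => U0; move/eqP: eps1; rewrite U0.
have := epsL (-1) 0 0; rewrite scaleN1r oppr0 addr0 scaleN1r addNr => ->.
by rewrite eq_sym oner_eq0.
Qed.
HB.instance Definition _ := GRing.PzSemiRing_isNonZero.Build Uq Uq_one_neq0.
HB.instance Definition _ :=
  GRing.LSemiModule_isLSemiAlgebra.Build K Uq (@pres_scalerAl _ _ Urel).
HB.instance Definition _ :=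
  GRing.LSemiAlgebra_isSemiAlgebra.Build K Uq (@pres_scalerAr _ _ Urel).

Definition uE : Uq := pgen Urel GE.
Definition uF : Uq := pgen Urel GF.
Definition uK : Uq := pgen Urel GK.
Definition uKV : Uq := pgen Urel GKV.

Lemma uKKV : uK * uKV = 1.
Proof. by rewrite -[RHS]scale1r -pclsC -pclsM; apply/pcls_rel/Urel_KKV. Qed.
Lemma uKVK : uKV * uK = 1.
Proof. by rewrite -[RHS]scale1r -pclsC -pclsM; apply/pcls_rel/Urel_KVK. Qed.
Lemma uKE : uK * uE = q *: (uE * uK).
Proof.
have := pcls_rel Urel_KE.
by rewrite !pclsM pclsC -!pres_scalerAl mul1r.
Qed.
Lemma uKF : uK * uF = q^-1 *: (uF * uK).
Proof.
have := pcls_rel Urel_KF.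
by rewrite !pclsM pclsC -!pres_scalerAl mul1r.
Qed.
Lemma uEF : uE * uF - uF * uE = (q - q^-1)^-1 *: (uK ^+ 2 - uKV ^+ 2).
Proof.
have := pcls_rel Urel_EF.
by rewrite !(pclsD, pclsM) !pclsC -!pres_scalerAl !mul1r !scaleN1r.
Qed.

Definition casimir : Uq :=
  (- ((q - q^-1) ^+ 2 / (q + q^-1))) *:
    (uF * uE + ((q - q^-1) ^+ 2)^-1 *: (q *: uK ^+ 2 + q^-1 *: uKV ^+ 2)).

(* The comultiplication: the algebra morphism with these values on the        *)
(* generators.                                                                *)
Definition Delta_gen (g : Ugen) : Uq ⊗ Uq :=
  match g with
  | GE => uE ⊗ uKV + uK ⊗ uE
  | GF => uF ⊗ uKV + uK ⊗ uF
  | GK => uK ⊗ uK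
  | GKV => uKV ⊗ uKV
  end.
Definition Delta : Uq -> Uq ⊗ Uq := plift Delta_gen.

(* The triple tensor power is taken to be U ⊗ (U ⊗ U); tassoc moves elements  *)
(* of (U ⊗ U) ⊗ U there.                                                      *)
Definition C1 : Uq ⊗ (Uq ⊗ Uq) := casimir ⊗ (1 ⊗ 1).
Definition C2 : Uq ⊗ (Uq ⊗ Uq) := 1 ⊗ (casimir ⊗ 1).
Definition C3 : Uq ⊗ (Uq ⊗ Uq) := 1 ⊗ (1 ⊗ casimir).
Definition C12 : Uq ⊗ (Uq ⊗ Uq) := tassoc (Delta casimir ⊗ 1).
Definition C23 : Uq ⊗ (Uq ⊗ Uq) := 1 ⊗ Delta casimir.
Definition C13 : Uq ⊗ (Uq ⊗ Uq) := tmap id (fun y => 1 ⊗ y) (Delta casimir).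
Definition C123 : Uq ⊗ (Uq ⊗ Uq) := tassoc (tmap Delta id (Delta casimir)).

Definition qcomm (A : algType K) (x y : A) : A :=
  q *: (x * y) - q^-1 *: (y * x).

Hypothesis q_neq0 : q != 0.

Lemma uEKV : uE * uKV = q *: (uKV * uE).
Proof.
by rewrite -[uE in LHS]mul1r -uKVK -[_ * _ * uE]mulrA uKE -scalerAr -scalerAl
  -!mulrA uKKV mulr1.
Qed.
Lemma uFKV : uF * uKV = q^-1 *: (uKV * uF).
Proof.
by rewrite -[uF in LHS]mul1r -uKVK -[_ * _ * uF]mulrA uKF -scalerAr -scalerAl
  -!mulrA uKKV mulr1.
Qed.

Lemma Delta_rel s t : Urel s t -> teval Delta_gen s = teval Delta_gen t.
Proof.
case=> /=; rewrite ?(scale1r, scaleN1r, mulN1r) -?scalerAl ?mul1r.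
- by rewrite tpureM uKKV tpure1.
- by rewrite tpureM uKVK tpure1.
- rewrite mulrDr mulrDl !tpureM !uKE uKKV uKVK scalerDr.
  by rewrite ?(tpureZl, tpureZr).
- rewrite mulrDr mulrDl !tpureM !uKF uKKV uKVK scalerDr.
  by rewrite ?(tpureZl, tpureZr).
- rewrite !mulrDr !mulrDl !tpureM uKE uKF uEKV uFKV.
  rewrite !(tpureZl, tpureZr) !scalerA mulVf // divff // !scale1r.
  set a := (uE * uK) ⊗ _; set b := (uF * uK) ⊗ _.
  have rearr (V : zmodType) (x y z u v w : V) :
      x + v + (w + y) - (z + w + (v + u)) = (x - z) + (y - u).
    rewrite addrACA opprD [LHS]addrACA; congr (_ + _).
      by rewrite addrC opprD addrACA addNr addr0 addrC.
    by rewrite opprD addrACA subrr add0r.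
  rewrite rearr.
  have subl (x x' y : Uq) : x ⊗ y - x' ⊗ y = (x - x') ⊗ y :> Uq ⊗ Uq.
    by rewrite tpureDl -scaleN1r -tpureZl scaleN1r.
  have subr (x y y' : Uq) : x ⊗ y - x ⊗ y' = x ⊗ (y - y') :> Uq ⊗ Uq.
    by rewrite tpureDr -scaleN1r -tpureZr scaleN1r.
  rewrite subl subr uEF tpureZl tpureZr -scalerDr -subl -subr -!expr2.
  by congr (_ *: _); rewrite addrC addrA subrK.
Qed.

Lemma Delta_monoid_morphism : monoid_morphism Delta.
Proof. exact/plift_monoid_morphism/Delta_rel. Qed.
Lemma Delta_linear : linear Delta.
Proof. exact/plift_linear/Delta_rel. Qed.

End QuantumSl2.

Section Completion.
Variables (K : fieldType) (q qh : K).
Local Notation U := (Uq q).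

(* V_n has a basis v_0, ..., v_n with v_i of weight n/2 - i, that is          *)
(*   q^H v_i = q^(n/2 - i) v_i,  F v_i = v_(i+1),                             *)
(*   E v_i = [i]_q [n - i + 1]_q v_(i-1).                                     *)
(* Elements of End(V_n) are matrices acting on column vectors.  Weights are   *)
(* doubled to be integers and q^(1/2) = qh, so that q^(n/2 - i) = qh^(n - 2i) *)
Definition wt (n i : nat) : int := n%:Z - (i.*2)%:Z.

Definition V_gen (n : nat) (g : Ugen) : 'M[K]_n.+1 :=
  match g with
  | GE => \matrix_(i, j) ((qint q j * qint q (n.+1 - j)) *+ (j == i.+1 :> nat))
  | GF => \matrix_(i, j) (i == j.+1 :> nat)%:R
  | GK => diag_mx (\row_i qh ^ wt n i)
  | GKV => diag_mx (\row_i qh ^ (- wt n i))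
  end.
Definition rep (n : nat) : U -> 'M[K]_n.+1 := plift (V_gen n).

(* The actions on V_(n1) ⊗ V_(n2) and V_(n1) ⊗ (V_(n2) ⊗ V_(n3)); *t is the   *)
(* Kronecker product of matrices.                                             *)
Definition rep2 (n1 n2 : nat) : U ⊗ U -> 'M[K]_(n1.+1 * n2.+1) :=
  tlift (fun x y => rep n1 x *t rep n2 y).
Definition rep3 (n1 n2 n3 : nat) :
    U ⊗ (U ⊗ U) -> 'M[K]_(n1.+1 * (n2.+1 * n3.+1)) :=
  tlift (fun x y => rep n1 x *t rep2 n2 n3 y).

(* The completions of U ⊗ U and of U ⊗ (U ⊗ U), with n = (n1, n2),            *)
(* resp. n = (n1, (n2, n3)).                                                  *)
Definition hat2 : Type :=
  prodring (fun n : nat * nat => 'M[K]_(n.1.+1 * n.2.+1)).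
Definition hat3 : Type :=
  prodring (fun n : nat * (nat * nat) =>
    'M[K]_(n.1.+1 * (n.2.1.+1 * n.2.2.+1))).
HB.instance Definition _ := GRing.PzRing.on hat2.
HB.instance Definition _ := GRing.PzRing.on hat3.

Definition embed3 (x : U ⊗ (U ⊗ U)) : hat3 := fun n => rep3 n.1 n.2.1 n.2.2 x.

(* q^(2 (H ⊗ H)): the eigenvalue q^(2 m m') on a tensor product of vectors of *)
(* weights m and m' is qh^((2 m) (2 m')).                                     *)
Definition q2HH : hat2 := fun n =>
  diag_mx (\row_k qh ^ (wt n.1 (mxtens_unindex k).1 *
                        wt n.2 (mxtens_unindex k).2)).

(* The series is finite on V_(n1) ⊗ V_(n2): the summands with k > min n1 n2   *)
(* vanish, see Rseries_nilp.                                                  *)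
Definition Rtilde : hat2 := fun n =>
  (\sum_(k < (minn n.1 n.2).+1)
     ((q - q^-1) ^+ k / qfact q k * q ^+ (k * k.-1)./2) *:
       rep2 n.1 n.2 ((uF q * uK q) ⊗ (uKV q * uE q)) ^+ k)
  * q2HH n.

Definition Rtilde23 : hat3 := fun n => 1%:M *t Rtilde n.2.
Definition Rtilde23V : hat3 := fun n => invmx (Rtilde23 n).

Definition C13_0 : hat3 := Rtilde23V * embed3 (C13 q) * Rtilde23.

Hypotheses (q_neq0 : q != 0) (qhE : qh ^+ 2 = q).

Let qh_neq0 : qh != 0.
Proof. by move: q_neq0; rewrite -qhE expf_eq0. Qed.

Lemma qh_wt n i : qh ^ wt n i = qh ^+ n / q ^+ i.
Proof. by rewrite /wt expfzDr // -exprnN -qhE -exprM mul2n. Qed.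

Lemma qh_wtN n i : qh ^ (- wt n i) = q ^+ i / qh ^+ n.
Proof. by rewrite -invr_expz qh_wt invf_div. Qed.

Lemma qint0 : qint q 0 = 0.
Proof. by rewrite /qint expr0 invr1 subrr mul0r. Qed.

Lemma qint_rel n i : (i <= n)%N ->
  qint q i.+1 * qint q (n - i) - qint q i * qint q (n.+1 - i) =
  (q - q^-1)^-1 * (qh ^ wt n i * qh ^ wt n i - qh ^ (- wt n i) * qh ^ (- wt n i)).
Proof.
move=> le_in; rewrite subSn // !(qh_wt, qh_wtN).
have [m ->] : exists m, n = (i + m)%N by exists (n - i)%N; rewrite subnKC.
rewrite addKn; have hN : qh ^+ (i + m) * qh ^+ (i + m) = q ^+ i * q ^+ m.
  by rewrite -exprMn -expr2 qhE exprD.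
rewrite (mulrACA (qh ^+ _)) (mulrACA (q ^+ i)) -!invfM hN /qint !exprS.
have DD : (q - q^-1)^-1 * (q - q^-1)^-1 * (q - q^-1) = (q - q^-1)^-1.
  have [->|nz] := eqVneq (q - q^-1) 0; first by rewrite invr0 !mulr0.
  by rewrite mulfVK.
have := q_neq0; have := expf_neq0 i q_neq0; have := expf_neq0 m q_neq0.
rewrite -[X in _ = X * _]DD.
move: (q - q^-1)^-1 (q ^+ i) (q ^+ m) => D a b b0 a0 q0.
by field; rewrite q0 a0 b0.
Qed.

Lemma V_rel n s t : Urel q s t -> teval (V_gen n) s = teval (V_gen n) t.
Proof.
case=> /=; rewrite ?(scale1r, scaleN1r, mulN1r) -?scalerAl ?mul1r.
- rewrite /GRing.mul /= mulmx_diag -[RHS]diag_const_mx; congr diag_mx; apply/rowP=> i.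
  by rewrite !mxE -expfzDr // addrN.
- rewrite /GRing.mul /= mulmx_diag -[RHS]diag_const_mx; congr diag_mx; apply/rowP=> i.
  by rewrite !mxE -expfzDr // addNr.
- rewrite /GRing.mul /= mul_diag_mx mul_mx_diag; apply/matrixP => i j; rewrite !mxE.
  case: eqP => [ji|_]; rewrite ?mulr1n ?mulr0n ?(mulr0, mul0r) //.
  rewrite mulrC mulrCA; congr (_ * _).
  by rewrite !qh_wt ji exprS; field; rewrite q_neq0 expf_neq0.
- rewrite /GRing.mul /= mul_diag_mx mul_mx_diag; apply/matrixP => i j; rewrite !mxE.
  case: eqP => [ij|_]; rewrite ?mulr1n ?mulr0n ?(mulr0, mul0r) //.
  by rewrite !qh_wt ij exprS; field; rewrite q_neq0 expf_neq0.
- rewrite /GRing.mul /= !mulmx_diag; apply/matrixP => i j; rewrite !mxE.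
  under eq_bigr do rewrite !mxE.
  under [X in _ - X]eq_bigr do rewrite !mxE.
  have -> : \sum_(k < n.+1) (qint q k * qint q (n.+1 - k) *+ (k == i.+1 :> nat)) * (k == j.+1 :> nat)%:R
     = (qint q i.+1 * qint q (n - i)) *+ (i == j).
    have [lt_in|le_ni] := ltnP i n.
      rewrite (bigD1 (inord i.+1)) //= inordK // eqxx mulr1n big1 ?addr0.
        by rewrite eqSS subSS mulr_natr; congr (_ *+ _); case: eqP => [->|] //; rewrite ?eqxx.
      by move=> k /eqP nk; case: eqP => [ki|]; rewrite ?mul0r //; case: nk; apply: val_inj; rewrite /= inordK.
    rewrite (eqP le_ni) qint0 mulr0 mul0rn big1 // => k _.
    by rewrite ltn_eqF ?mul0r // (leq_trans (ltn_ord k)).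
  have -> : \sum_(k < n.+1) (i == k.+1 :> nat)%:R * (qint q j * qint q (n.+1 - j) *+ (j == k.+1 :> nat))
     = (qint q i * qint q (n.+1 - i)) *+ (i == j).
    case: (posnP i) => [i0|i_gt0].
      rewrite big1; last by move=> k _; rewrite i0 mul0r.
      by rewrite i0 qint0 !mul0r mul0rn.
    have lti : (i.-1 < n.+1)%N by rewrite (leq_ltn_trans (leq_pred _)).
    rewrite (bigD1 (inord i.-1)) //= inordK // prednK // eqxx mul1r big1 ?addr0.
      by rewrite (eq_sym (j : nat)); case: eqP => [/val_inj ->|]; rewrite ?eqxx // => ij; case: eqP => // E; case: ij; rewrite E.
    by move=> k /eqP nk; case: eqP => [ik|]; rewrite ?mul0r //; case: nk; apply: val_inj; rewrite /= inordK // ik.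
  rewrite -mulrnBl -mulrnBl mulrnAr qint_rel // -ltnS; exact: ltn_ord.
Qed.

Lemma rep_monoid_morphism n : monoid_morphism (rep n).
Proof. exact/plift_monoid_morphism/V_rel. Qed.
Lemma rep_linear n : linear (rep n).
Proof. exact/plift_linear/V_rel. Qed.

Let tensmx_lin m n p r c (A A' : 'M[K]_(m, n)) (B : 'M[K]_(p, r)) :
  (c *: A + A') *t B = c *: (A *t B) + A' *t B.
Proof. by apply/matrixP=> i j; rewrite !mxE mulrDl -mulrA. Qed.
Let tensmx_linr m n p r c (A : 'M[K]_(m, n)) (B B' : 'M[K]_(p, r)) :
  A *t (c *: B + B') = c *: (A *t B) + A *t B'.
Proof. by apply/matrixP=> i j; rewrite !mxE mulrDr mulrCA. Qed.

Let rep2_lin n1 n2 :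
  (forall y, linear (fun x => rep n1 x *t rep n2 y)) /\
  (forall x, linear (fun y => rep n1 x *t rep n2 y)).
Proof.
by split=> [y|x] c u v /=; rewrite rep_linear ?tensmx_lin ?tensmx_linr.
Qed.

Lemma rep2_pure n1 n2 x y : rep2 n1 n2 (x ⊗ y) = rep n1 x *t rep n2 y.
Proof.
by have [l r] := rep2_lin n1 n2; rewrite /rep2 tlift_pure //; apply: bilinear_balanced.
Qed.

Lemma rep2_linear n1 n2 : linear (rep2 n1 n2).
Proof. by have [l r] := rep2_lin n1 n2; apply: tlift_linear. Qed.

Let rep3_lin n1 n2 n3 :
  (forall y, linear (fun x => rep n1 x *t rep2 n2 n3 y)) /\
  (forall x, linear (fun y => rep n1 x *t rep2 n2 n3 y)).
Proof.
split=> [y|x] c u v /=; first by rewrite rep_linear tensmx_lin.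
by rewrite rep2_linear tensmx_linr.
Qed.

Lemma rep3_pure n1 n2 n3 x y : rep3 n1 n2 n3 (x ⊗ y) = rep n1 x *t rep2 n2 n3 y.
Proof.
by have [l r] := rep3_lin n1 n2 n3; rewrite /rep3 tlift_pure //; apply: bilinear_balanced.
Qed.

Lemma rep3_linear n1 n2 n3 : linear (rep3 n1 n2 n3).
Proof. by have [l r] := rep3_lin n1 n2 n3; apply: tlift_linear. Qed.

Let linD (V W : lmodType K) (f : V -> W) : linear f -> {morph f : x y / x + y}.
Proof. by move=> fL x y; have := fL 1 x y; rewrite !scale1r. Qed.
Let lin0 (V W : lmodType K) (f : V -> W) : linear f -> f 0 = 0.
Proof. by move=> /linD fD; apply: (addrI (f 0)); rewrite -fD !addr0. Qed.

Let tens11 m n : (1 : 'M[K]_m) *t (1 : 'M[K]_n) = 1.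
Proof.
apply/matrixP=> i j; rewrite !mxE -natrM mulnb -(can_eq (@mxtens_unindexK m n)).
by rewrite -pair_eqE.
Qed.

Lemma rep2_monoid_morphism n1 n2 : monoid_morphism (rep2 n1 n2).
Proof.
have rL := rep2_linear n1 n2; split.
  rewrite -tpure1 rep2_pure (rep_monoid_morphism n1).1 (rep_monoid_morphism n2).1.
  exact: tens11.
move=> x y; elim/tens_ind: x => [|a b|x1 x2 IH1 IH2].
- by rewrite mul0r (lin0 rL) mul0r.
- elim/tens_ind: y => [|c d|y1 y2 IH1 IH2].
  + by rewrite mulr0 (lin0 rL) mulr0.
  + rewrite tpureM !rep2_pure (rep_monoid_morphism n1).2 (rep_monoid_morphism n2).2.
    by rewrite [RHS]tensmx_mul.
  + by rewrite mulrDr !(linD rL) IH1 IH2 mulrDr.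
- by rewrite mulrDl !(linD rL) IH1 IH2 mulrDl.
Qed.

Lemma rep3_monoid_morphism n1 n2 n3 : monoid_morphism (rep3 n1 n2 n3).
Proof.
have rL := rep3_linear n1 n2 n3; split.
  rewrite -tpure1 rep3_pure (rep_monoid_morphism n1).1 (rep2_monoid_morphism n2 n3).1.
  exact: tens11.
move=> x y; elim/tens_ind: x => [|a b|x1 x2 IH1 IH2].
- by rewrite mul0r (lin0 rL) mul0r.
- elim/tens_ind: y => [|c d|y1 y2 IH1 IH2].
  + by rewrite mulr0 (lin0 rL) mulr0.
  + rewrite tpureM !rep3_pure (rep_monoid_morphism n1).2 (rep2_monoid_morphism n2 n3).2.
    by rewrite [RHS]tensmx_mul.
  + by rewrite mulrDr !(linD rL) IH1 IH2 mulrDr.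
- by rewrite mulrDl !(linD rL) IH1 IH2 mulrDl.
Qed.

Let rep_gen n g : rep n (pgen (Urel q) g) = V_gen n g.
Proof. exact/plift_gen/V_rel. Qed.

Let N n1 n2 := rep2 n1 n2 ((uF q * uK q) ⊗ (uKV q * uE q)).

Let N_supp n1 n2 k a b : (N n1 n2 ^+ k) a b != 0 ->
  (mxtens_unindex a).1 = ((mxtens_unindex b).1 + k)%N :> nat /\
  (mxtens_unindex b).2 = ((mxtens_unindex a).2 + k)%N :> nat.
Proof.
have N1 c d : N n1 n2 c d != 0 ->
  (mxtens_unindex c).1 = (mxtens_unindex d).1.+1 :> nat /\
  (mxtens_unindex d).2 = (mxtens_unindex c).2.+1 :> nat.
  rewrite /N rep2_pure !(rep_monoid_morphism _).2 !rep_gen /=.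
  rewrite -[_ * _]/(_ *m _) mul_mx_diag -[diag_mx _ * _]/(_ *m _) mul_diag_mx !mxE.
  case: (_.1 =P _) => [E1|_]; last by rewrite !mul0r eqxx.
  case: (nat_of_ord _.2 =P _) => [E2|_]; last by rewrite mulr0n !mulr0 eqxx.
  by move=> _; split; [exact: E1|exact: E2].
elim: k a b => [|k IHk] a b.
  by rewrite expr0 mxE !addn0; case: (a =P b) => [-> _|_]; rewrite ?eqxx.
rewrite exprS mxE => nz.
have [c /andP[Nac Ncb]] : exists c, (N n1 n2 a c != 0) && ((N n1 n2 ^+ k) c b != 0).
  apply/existsP; apply: contraNT nz => /existsPn z; rewrite big1 // => c _.
  by have := z c; rewrite negb_and !negbK => /orP[] /eqP ->; rewrite ?mul0r ?mulr0.
have [-> E2] := N1 _ _ Nac; have [-> ->] := IHk _ _ Ncb.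
by rewrite addnS E2 addSnnS.
Qed.

Lemma Rseries_nilp n1 n2 k : (minn n1 n2 < k)%N -> 
  rep2 n1 n2 ((uF q * uK q) ⊗ (uKV q * uE q)) ^+ k = 0.
Proof.
rewrite -/(N n1 n2) => lt_k; apply/matrixP => a b; rewrite [RHS]mxE; apply/eqP.
apply: contraLR lt_k => /N_supp [E1 E2]; rewrite -leqNgt leq_min.
apply/andP; split.
  by rewrite -ltnS (leq_ltn_trans _ (ltn_ord (mxtens_unindex a).1)) // E1 leq_addl.
by rewrite -ltnS (leq_ltn_trans _ (ltn_ord (mxtens_unindex b).2)) // E2 leq_addl.
Qed.

Lemma Rtilde_unit n : Rtilde n \in unitmx.
Proof.
rewrite /Rtilde; set S := \sum_(k < _) _.
have Sent a b : S a b = \sum_(k < (minn n.1 n.2).+1)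
   ((q - q^-1) ^+ k / qfact q k * q ^+ (k * k.-1)./2) * (N n.1 n.2 ^+ k) a b.
  by rewrite /S summxE; apply: eq_bigr => k _; rewrite mxE.
rewrite [_ * _]/(_ *m _) unitmx_mul; apply/andP; split.
  have Strig : is_trig_mx S.
    apply/is_trig_mxP => a b lt_ab; rewrite Sent big1 // => k _.
    have [->|/N_supp [E1 E2]] := eqVneq ((N n.1 n.2 ^+ k) a b) 0; first by rewrite mulr0.
    move: lt_ab; rewrite -(mxtens_unindexK a) -(mxtens_unindexK b).
    move: E1 E2; case: (mxtens_unindex a) (mxtens_unindex b) => [i j] [i' j'] /= -> E2.
    rewrite ltnNge E2 mulnDl -addnA leq_add2l addnC leq_add2r.
    have : (k <= n.2)%N by rewrite -ltnS (leq_ltn_trans _ (ltn_ord j')) // E2 leq_addl.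
    by rewrite leq_pmulr.
  rewrite unitmxE det_trig // unitfE prodf_seq_neq0; apply/allP => a _ /=.
  rewrite Sent big_ord_recl big1 ?addr0.
    by rewrite /= !expr0 mxE eqxx /qfact big_geq // divr1 !mulr1 oner_neq0.
  move=> k _; have [->|/N_supp [/eqP]] := eqVneq ((N n.1 n.2 ^+ lift ord0 k) a a) 0.
    by rewrite mulr0.
  by rewrite -[X in X == _]addn0 eqn_add2l.
rewrite unitmxE det_diag unitfE prodf_seq_neq0; apply/allP => a _ /=.
by rewrite mxE expfz_neq0.
Qed.

Lemma Rtilde23V_inverse :
  Rtilde23 * Rtilde23V = 1 /\ Rtilde23V * Rtilde23 = 1.
Proof.
have u n : Rtilde23 n \in unitmx.
  by apply: tensmx_unit; rewrite ?unitmx1 ?Rtilde_unit.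
split; apply/prodringP => n; first exact: (mulmxV (u n)).
exact: (mulVmx (u n)).
Qed.

End Completion.

(* Main.v *)
Require Import Defs.
From mathcomp Require Import all_boot all_order all_algebra.
From mathcomp Require Import reals complex mxtens ring.

(** With k = q^H, k' = q^(-H), D = q - q^(-1) and kap = - D^2 / (q + q^(-1)), one
    has
      Delta(C) = C ⊗ k'^2 + k^2 ⊗ C + k^2 ⊗ k'^2
                 + kap (F k ⊗ k' E + k E ⊗ F k').
    Hence C13 involves its third tensor factor only through C, k'^2, k' E and
    F k', and it suffices to conjugate 1 ⊗ X by R = theta * q^(2 H⊗H) for these
    four X, where theta is a q-exponential of x = F k ⊗ k' E.  The elements
    1 ⊗ C and 1 ⊗ k' E commute with x, while z x = q^(-2) x z for z = 1 ⊗ k'^2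
    and z = k ⊗ k', which gives z theta = theta (1 - q^(-1) D^2 x) z.  Last,
    1 ⊗ F k' = w z with w = k' ⊗ F and z = k ⊗ k', where
      x w - w x = (g - g') / D,   g = F ⊗ k,   g' = F ⊗ k'^3,
    so that w theta = theta w + theta g' - g theta, and the infinite sums cancel
    in w z theta because g z = F k ⊗ 1 commutes with x.  The resulting conjugates
    lie in U ⊗ U, and in U^(⊗3) the identity reduces to q-commutators of the
    coefficients of Delta(C) in the middle factor. *)

Set Implicit Arguments.
Unset Strict Implicit.
Unset Printing Implicit Defensive.

Import GRing.Theory.
Local Open Scope ring_scope.

(** * Equalities of linear combinations by reflection *)

Section LinearCombinations.
Variables (K : pzRingType) (V : lmodType K).

Inductive lexpr :=
  | LVar of nat
  | LZero
  | LAdd of lexpr & lexpr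
  | LOpp of lexpr
  | LScale of K & lexpr.

Fixpoint leval (e : seq V) (t : lexpr) : V :=
  match t with
  | LVar j => nth 0 e j
  | LZero => 0
  | LAdd t u => leval e t + leval e u
  | LOpp t => - leval e t
  | LScale c t => c *: leval e t
  end.

Fixpoint lcoef (t : lexpr) (i : nat) : K :=
  match t with
  | LVar j => if eqn j i then 1 else 0
  | LZero => 0
  | LAdd t u => lcoef t i + lcoef u i
  | LOpp t => - lcoef t i
  | LScale c t => c * lcoef t i
  end.

(** A recursive conjunction, so that for a concrete [n] it computes to one goal per atom. *)
Fixpoint lcoef_eq (n : nat) (t u : lexpr) : Prop :=
  if n is m.+1 then lcoef t m = lcoef u m /\ lcoef_eq m t u else True.

Lemma leval_coef e t : leval e t = \sum_(i < size e) lcoef t i *: e`_i.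
Proof.
elim: t => [j||t IHt u IHu|t IHt|c t IHt] /=.
- have [lt_j|le_j] := ltnP j (size e).
    rewrite (bigD1 (Ordinal lt_j)) //= -[eqn j j]/(j == j) eqxx scale1r.
    rewrite big1 ?addr0 // => i ne_ij; rewrite -[eqn j i]/(j == i).
    by case: eqP => [ji|_]; [case/eqP: ne_ij; apply: val_inj|rewrite scale0r].
  rewrite nth_default // big1 // => i _; rewrite -[eqn j i]/(j == i).
  by rewrite gtn_eqF ?scale0r // (leq_trans (ltn_ord i)).
- by rewrite big1 // => i _; rewrite scale0r.
- by rewrite IHt IHu -big_split; apply: eq_bigr => i _; rewrite scalerDl.
- by rewrite IHt -sumrN; apply: eq_bigr => i _; rewrite scaleNr.
- by rewrite IHt scaler_sumr; apply: eq_bigr => i _; rewrite scalerA.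
Qed.

Lemma leval_eq e t u : lcoef_eq (size e) t u -> leval e t = leval e u.
Proof.
rewrite !leval_coef; elim: (size e) => [|n IHn] /=; first by rewrite !big_ord0.
by move=> [eq_n /IHn eq_tu]; rewrite !big_ord_recr /= eq_n eq_tu.
Qed.

End LinearCombinations.

(* Atoms are compared up to conversion, since the canonical structures in     *)
(* them may have been inferred along different paths.                         *)
Ltac lin_index v e :=
  lazymatch e with
  | ?w :: ?e' =>
    match goal with
    | _ => let _ := match goal with _ => unify v w end in constr:(0%N)
    | _ => let i := lin_index v e' in constr:(i.+1)
    end
  end.

Ltac lin_atoms t e :=
  lazymatch t with
  | ?t1 + ?t2 => let e' := lin_atoms t1 e in lin_atoms t2 e'
  | - ?t1 => lin_atoms t1 e
  | _ *: ?t1 => lin_atoms t1 e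
  | 0 => e
  | _ => match goal with
         | _ => let _ := lin_index t e in e
         | _ => constr:(t :: e)
         end
  end.

Ltac lin_quote K t e :=
  lazymatch t with
  | ?t1 + ?t2 => let r1 := lin_quote K t1 e in let r2 := lin_quote K t2 e in
                 constr:(@LAdd K r1 r2)
  | - ?t1 => let r1 := lin_quote K t1 e in constr:(@LOpp K r1)
  | ?c *: ?t1 => let r1 := lin_quote K t1 e in constr:(@LScale K c r1)
  | 0 => constr:(@LZero K)
  | _ => let i := lin_index t e in constr:(@LVar K i)
  end.

(* Leaves one scalar equation for each atom of the two linear combinations.   *)
Ltac lin_coefs K :=
  lazymatch goal with |- @eq ?V ?t ?u =>
    let e0 := lin_atoms t (@nil V) in
    let e := lin_atoms u e0 in
    let r := lin_quote K t e in
    let r' := lin_quote K u e in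
    apply: (@leval_eq K _ e r r'); cbn [lcoef_eq lcoef eqn size]; repeat split
  end.

(** * Computations from the quantum sl_2 relations in an arbitrary algebra *)

Record quantum_sl2 (K : fieldType) (q : K) (A : algType K) (E F k k' : A) :
    Prop := QuantumSl2 {
  qsl2_q_neq0 : q != 0;
  qsl2_D_neq0 : q - q^-1 != 0;
  qsl2_s_neq0 : q + q^-1 != 0;
  qsl2_kk' : k * k' = 1;
  qsl2_k'k : k' * k = 1;
  qsl2_kE : k * E = q *: (E * k);
  qsl2_kF : k * F = q^-1 *: (F * k);
  qsl2_EF : E * F - F * E = (q - q^-1)^-1 *: (k ^+ 2 - k' ^+ 2)
}.

(** On the generators of [Uq q] this is convertible with [casimir q]. *)
Definition qcasimir (K : fieldType) (q : K) (A : algType K) (E F k k' : A) : A :=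
  (- ((q - q^-1) ^+ 2 / (q + q^-1))) *:
    (F * E + ((q - q^-1) ^+ 2)^-1 *: (q *: k ^+ 2 + q^-1 *: k' ^+ 2)).

(** An abstract stand-in for [x ⊗ y], whose unfolding would slow down rewriting. *)
Record pair_map (K : fieldType) (A W : algType K) (P : A -> A -> W) : Prop :=
    PairMap {
  pair_mapDl : forall y, {morph P^~ y : x x' / x + x'};
  pair_mapDr : forall x, {morph P x : y y' / y + y'};
  pair_mapZl : forall c x y, P (c *: x) y = c *: P x y;
  pair_mapZr : forall c x y, P x (c *: y) = c *: P x y;
  pair_mapM : forall x y x' y', P x y * P x' y' = P (x * x') (y * y')
}.

Lemma tpure_pair_map (K : fieldType) (A : algType K) :
  pair_map (fun x y : A => x ⊗ y : A ⊗ A).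
Proof.
split; [exact: tpureDl|exact: tpureDr|exact: tpureZl|exact: tpureZr|].
by move=> x y x' y'; rewrite tpureM.
Qed.

Section QuantumRelations.
Variables (K : fieldType) (q : K) (A : algType K) (E F k k' : A).
Hypothesis rel : quantum_sl2 q E F k k'.

Local Notation kap := (- ((q - q^-1) ^+ 2 / (q + q^-1))).
Local Notation C := (qcasimir q E F k k').

Let q_neq0 := qsl2_q_neq0 rel.
Let D_neq0 := qsl2_D_neq0 rel.
Let s_neq0 := qsl2_s_neq0 rel.
Let kk' := qsl2_kk' rel.
Let k'k := qsl2_k'k rel.
Let kE := qsl2_kE rel.
Let kF := qsl2_kF rel.

Let EF_FE : E * F = F * E + (q - q^-1)^-1 *: (k * k - k' * k').
Proof. by rewrite -!expr2 -(qsl2_EF rel) addrC subrK. Qed.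
Let k'E : k' * E = q^-1 *: (E * k').
Proof.
by rewrite -[E in LHS]mulr1 -kk' [E * _]mulrA -[E * k]scale1r -(mulVf q_neq0)
  -scalerA -kE -!scalerAl -scalerAr -mulrA !mulrA k'k mul1r.
Qed.
Let k'F : k' * F = q *: (F * k').
Proof.
by rewrite -[F in LHS]mulr1 -kk' [F * _]mulrA -[F * k]scale1r -(mulfV q_neq0)
  -scalerA -kF -!scalerAl -scalerAr -mulrA !mulrA k'k mul1r.
Qed.
Let kEr z : k * (E * z) = q *: (E * (k * z)).
Proof. by rewrite mulrA kE -scalerAl mulrA. Qed.
Let kFr z : k * (F * z) = q^-1 *: (F * (k * z)).
Proof. by rewrite mulrA kF -scalerAl mulrA. Qed.
Let k'Er z : k' * (E * z) = q^-1 *: (E * (k' * z)).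
Proof. by rewrite mulrA k'E -scalerAl mulrA. Qed.
Let k'Fr z : k' * (F * z) = q *: (F * (k' * z)).
Proof. by rewrite mulrA k'F -scalerAl mulrA. Qed.
Let kk'r z : k * (k' * z) = z.
Proof. by rewrite mulrA kk' mul1r. Qed.
Let k'kr z : k' * (k * z) = z.
Proof. by rewrite mulrA k'k mul1r. Qed.
Let EFr z :
  E * (F * z) = F * (E * z) + (q - q^-1)^-1 *: (k * (k * z) - k' * (k' * z)).
Proof. by rewrite mulrA EF_FE mulrDl -scalerAl mulrBl -!mulrA. Qed.

(* Rewrites to right-nested words in which F, E and k, k' come in this order. *)
Let pbw := (kE, kF, k'E, k'F, kEr, kFr, k'Er, k'Fr, kk', k'k, kk'r, k'kr,
  EF_FE, EFr, =^~ scalerAl, =^~ scalerAr, =^~ @mulrA A,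
  @mulrDl A, @mulrDr A, @mulrBl A, @mulrBr A, @mulNr A, @mulrN A, scalerA,
  @mulr1 A, @mul1r A, @expr2 A).

(** [field] clears [q^-1], so the side conditions on [q - q^-1] and [q + q^-1] appear in this form
    and the next. *)
Let q2D_neq0 : q * q - 1 != 0.
Proof. by rewrite -(mulfV q_neq0) -mulrBr mulf_neq0. Qed.
Let q2s_neq0 : q * q + 1 != 0.
Proof. by rewrite -(mulfV q_neq0) -mulrDr mulf_neq0. Qed.

Ltac pbw_tac :=
  rewrite !pbw; lin_coefs K; field; by rewrite ?q_neq0 ?q2s_neq0 ?q2D_neq0.

Lemma casimir_comm_k : C * k = k * C.
Proof. by rewrite /qcasimir; pbw_tac. Qed.

Lemma casimir_comm_k' : C * k' = k' * C.
Proof. by rewrite /qcasimir; pbw_tac. Qed.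

Lemma casimir_comm_E : C * E = E * C.
Proof. by rewrite /qcasimir; pbw_tac. Qed.

Lemma casimir_comm_F : C * F = F * C.
Proof. by rewrite /qcasimir; pbw_tac. Qed.

(** From here to [qcomm_kk_kk]: the middle factors k'^2, k' E, F k' of C12 against the middle
    factors k^2, F k, k E of C23. Those that involve C follow from its centrality. *)
Lemma qcomm_kk_Fk : qcomm q (k' ^+ 2) (F * k) = (q ^+ 3 - q^-1) *: (F * k').
Proof. by rewrite /qcomm; pbw_tac. Qed.

Lemma qcomm_kk_kE : qcomm q (k' ^+ 2) (k * E) = 0.
Proof. by rewrite /qcomm; pbw_tac. Qed.

Lemma qcomm_kE_kk : qcomm q (k' * E) (k ^+ 2) = 0.
Proof. by rewrite /qcomm; pbw_tac. Qed.

Lemma qcomm_kE_Fk : qcomm q (k' * E) (F * k) =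
  (- ((q + q^-1) / (q - q^-1))) *: (C + k' ^+ 2).
Proof. by rewrite /qcomm /qcasimir; pbw_tac. Qed.

Lemma qcomm_kE_kE : qcomm q (k' * E) (k * E) = 0.
Proof. by rewrite /qcomm; pbw_tac. Qed.

Lemma qcomm_Fk_kk :
  qcomm q (F * k') (k ^+ 2) = (q^-1 * (q - q^-1) * (q + q^-1)) *: (F * k).
Proof. by rewrite /qcomm; pbw_tac. Qed.

Lemma qcomm_Fk_Fk :
  qcomm q (F * k') (F * k) = ((q - q^-1) * (q + q^-1)) *: F ^+ 2.
Proof. by rewrite /qcomm; pbw_tac. Qed.

Lemma qcomm_Fk_kE : qcomm q (F * k') (k * E) =
  (- ((q + q^-1) / (q - q^-1))) *: (C + k ^+ 2).
Proof. by rewrite /qcomm /qcasimir; pbw_tac. Qed.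

Lemma qcomm_kk_kk : qcomm q (k' ^+ 2) (k ^+ 2) = (q - q^-1) *: 1.
Proof. by rewrite /qcomm; pbw_tac. Qed.

Section Pairs.
Variables (W : algType K) (P : A -> A -> W).
Hypothesis Pmap : pair_map P.

Let PDl := pair_mapDl Pmap.
Let PDr := pair_mapDr Pmap.
Let PZl := pair_mapZl Pmap.
Let PZr := pair_mapZr Pmap.
Let PM := pair_mapM Pmap.

Let PNl x y : P (- x) y = - P x y.
Proof. by rewrite -scaleN1r PZl scaleN1r. Qed.
Let PNr x y : P x (- y) = - P x y.
Proof. by rewrite -scaleN1r PZr scaleN1r. Qed.

Ltac pair_tac :=
  rewrite ?exprS ?expr0 !(@mulrDr W, @mulrDl W, @mulrN W, @mulNr W,
    =^~ @scalerAl _ W, =^~ @scalerAr _ W, PM, pbw, PDl, PDr, PZl, PZr, PNl, PNr);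
  lin_coefs K; field; by rewrite ?q_neq0 ?q2s_neq0 ?q2D_neq0.

Local Notation x := (P (F * k) (k' * E)).
Local Notation w := (P k' F).
Local Notation g := (P F k).
Local Notation g' := (P F (k' ^+ 3)).

Lemma pair_skew_k'k' : P 1 (k' ^+ 2) * x = q ^- 2 *: (x * P 1 (k' ^+ 2)).
Proof. by pair_tac. Qed.

Lemma pair_comm_k'E : P 1 (k' * E) * x = x * P 1 (k' * E).
Proof. by pair_tac. Qed.

Lemma pair_comm_casimir : P 1 C * x = x * P 1 C.
Proof.
rewrite !PM !mul1r !mulr1; congr (P _ _).
by rewrite mulrA casimir_comm_k' -!mulrA casimir_comm_E.
Qed.

(** The powers of q in w x cancel, so the difference is F ⊗ k' [E, F]. *)
Lemma pair_shift : x * w - w * x = (q - q^-1)^-1 *: (g - g').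
Proof. by pair_tac. Qed.

Lemma pair_skew_Fk : x * g = q ^- 2 *: (g * x).
Proof. by pair_tac. Qed.

Lemma pair_skew_Fk' : g' * x = q ^- 2 *: (x * g').
Proof. by pair_tac. Qed.

Lemma pair_skew_kk' : P k k' * x = q ^- 2 *: (x * P k k').
Proof. by pair_tac. Qed.

Lemma pair_comm_Fk : P (F * k) 1 * x = x * P (F * k) 1.
Proof. by pair_tac. Qed.

(* The conjugates of x, w, g' by q^(2 H⊗H). *)
Local Notation xq :=
  (P F (k ^+ 2) * P k 1 * P 1 k' * P (k' ^+ 2) E).
Local Notation wq := (P k' 1 * P (k ^+ 2) F).
Local Notation gq := (P F (k ^+ 2) * (P 1 k' * P 1 k' * P 1 k')).
Local Notation u := (1 - (q^-1 * (q - q^-1) ^+ 2) *: xq).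

(** This and the next two identities simplify what results from moving the words produced by theta
    past q^(2 H⊗H). *)
Lemma pair_conj_k'k' : u * (P 1 k' * P 1 k') =
  P 1 (k' ^+ 2) - (q * (q - q^-1) ^+ 2) *: P (F * k') (k' * E).
Proof. by rewrite mulrBl mul1r; pair_tac. Qed.

(** In the first factor k^2 from F and k'^2 from E cancel. *)
Lemma pair_conj_casimir : kap *: (P (k ^+ 2) F * P (k' ^+ 2) E
    + ((q - q^-1) ^+ 2)^-1 *:
      (q *: (P 1 k * P 1 k) + q^-1 *: (P 1 k' * P 1 k'))) = P 1 C.
Proof. by rewrite /qcasimir; pair_tac. Qed.

(** C enters through the product F E in the second factor of [wq * xq]; the F^2 term comes from
    [gq * xq]. *)
Lemma pair_conj_Fk' : (wq + gq) * u * (P k 1 * P 1 k') - P F (k ^+ 2) * P k 1 =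
  P (k ^+ 2) (F * k')
  + ((q + q^-1) / q) *: (P (F * k) (k' ^+ 2) + P (F * k) C)
  - (q - q^-1) ^+ 2 *: P (F ^+ 2) (k' * E).
Proof. by rewrite /qcasimir mulrBr mulr1; pair_tac. Qed.

End Pairs.
End QuantumRelations.

(** * q-commutators and the identity for triple products *)

Section QCommutators.
Variables (K : fieldType) (q : K) (A : algType K).

Lemma qcommDl (x x' y : A) :
  qcomm q (x + x') y = qcomm q x y + qcomm q x' y.
Proof. by rewrite /qcomm mulrDl mulrDr !scalerDr opprD addrACA. Qed.
Lemma qcommDr (x y y' : A) :
  qcomm q x (y + y') = qcomm q x y + qcomm q x y'.
Proof. by rewrite /qcomm mulrDl mulrDr !scalerDr opprD addrACA. Qed.
Lemma qcommZl c (x y : A) : qcomm q (c *: x) y = c *: qcomm q x y.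
Proof.
rewrite /qcomm -!(scalerAl, scalerAr) scalerBr !scalerA.
by rewrite ![c * _]mulrC.
Qed.
Lemma qcommZr c (x y : A) : qcomm q x (c *: y) = c *: qcomm q x y.
Proof.
rewrite /qcomm -!(scalerAl, scalerAr) scalerBr !scalerA.
by rewrite ![c * _]mulrC.
Qed.
Lemma qcomm_comm (x y : A) :
  y * x = x * y -> qcomm q x y = (q - q^-1) *: (x * y).
Proof. by rewrite /qcomm scalerBl => ->. Qed.

End QCommutators.

(* The product map P stands for (x, y, z) |-> x ⊗ y ⊗ z; keeping it abstract   *)
(* spares the rewriting below the unfolding of the tensor products.           *)
Section TripleProductIdentity.
Variables (K : fieldType) (q : K) (A W : algType K) (E F k k' : A).
Variable P : A -> A -> A -> W.
Hypothesis rel : quantum_sl2 q E F k k'.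
Hypotheses (PDl : forall y z, {morph (fun x => P x y z) : x x' / x + x'})
  (PDm : forall x z, {morph (fun y => P x y z) : y y' / y + y'})
  (PDr : forall x y, {morph P x y : z z' / z + z'}).
Hypotheses (PZl : forall c x y z, P (c *: x) y z = c *: P x y z)
  (PZm : forall c x y z, P x (c *: y) z = c *: P x y z)
  (PZr : forall c x y z, P x y (c *: z) = c *: P x y z).
Hypothesis PM : forall x y z x' y' z',
  P x y z * P x' y' z' = P (x * x') (y * y') (z * z').

Local Notation kap := (- ((q - q^-1) ^+ 2 / (q + q^-1))).
Local Notation C := (qcasimir q E F k k').

Let q_neq0 := qsl2_q_neq0 rel.
Let D_neq0 := qsl2_D_neq0 rel.
Let s_neq0 := qsl2_s_neq0 rel.
Let q2D_neq0 : q * q - 1 != 0.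
Proof. by rewrite -(mulfV q_neq0) -mulrBr mulf_neq0. Qed.
Let q2s_neq0 : q * q + 1 != 0.
Proof. by rewrite -(mulfV q_neq0) -mulrDr mulf_neq0. Qed.

(* C12, C23 and C123, written out by means of Delta_casimir.                  *)
Definition P12 : W := P C (k' ^+ 2) 1 + P (k ^+ 2) C 1
  + kap *: (P (F * k) (k' * E) 1 + P (k * E) (F * k') 1)
  + P (k ^+ 2) (k' ^+ 2) 1.

Definition P23 : W := P 1 C (k' ^+ 2) + P 1 (k ^+ 2) C
  + kap *: (P 1 (F * k) (k' * E) + P 1 (k * E) (F * k'))
  + P 1 (k ^+ 2) (k' ^+ 2).

Definition P123 : W := P C (k' ^+ 2) (k' ^+ 2) + P (k ^+ 2) C (k' ^+ 2)
  + kap *: (P (F * k) (k' * E) (k' ^+ 2) + P (k * E) (F * k') (k' ^+ 2))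
  + P (k ^+ 2) (k' ^+ 2) (k' ^+ 2) + P (k ^+ 2) (k ^+ 2) C
  + kap *: (P (F * k) 1 (k' * E) + P (k ^+ 2) (F * k) (k' * E)
          + (P (k * E) 1 (F * k') + P (k ^+ 2) (k * E) (F * k')))
  + P (k ^+ 2) (k ^+ 2) (k' ^+ 2).

(* The conjugate of C13 by the R-matrix acting on the last two factors; see   *)
(* C13_Rtilde.                                                                *)
Definition P13_conj : W :=
  P C 1 (k' ^+ 2) - (q * (q - q^-1) ^+ 2) *: P C (F * k') (k' * E)
  + P (k ^+ 2) 1 C
  + kap *: (P (F * k) (k' ^+ 2) (k' * E) + P (k * E) (k ^+ 2) (F * k')
     + ((q + q^-1) / q) *: (P (k * E) (F * k) (k' ^+ 2)
                          + P (k * E) (F * k) C)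
     - (q - q^-1) ^+ 2 *: P (k * E) (F ^+ 2) (k' * E))
  + P (k ^+ 2) 1 (k' ^+ 2)
  - (q * (q - q^-1) ^+ 2) *: P (k ^+ 2) (F * k') (k' * E).

Let P0m x z : P x 0 z = 0.
Proof. by rewrite -(scale0r 0) PZm scale0r. Qed.

(** C12 has 1 in its third factor and C23 has 1 in its first, so only the middle factors fail to
    commute. *)
Let qcommP x m n y : qcomm q (P x m 1) (P 1 n y) = P x (qcomm q m n) y.
Proof. by rewrite /qcomm PDm -!scaleNr !PZm !PM !mulr1 !mul1r. Qed.

Let central x : C * x = x * C -> qcomm q x C = (q - q^-1) *: (C * x).
Proof. by move=> Cx; rewrite qcomm_comm Cx. Qed.

Lemma qcomm_P12_P23 : (q - q^-1)^-1 *: qcomm q P12 P23 =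
  P13_conj + (P C 1 1 * P 1 1 C + P 1 C 1 * P123).
Proof.
have CF := casimir_comm_F rel; have CE := casimir_comm_E rel.
have Ck := casimir_comm_k rel; have Ck' := casimir_comm_k' rel.
have commM x y : C * x = x * C -> C * y = y * C -> C * (x * y) = x * y * C.
  by move=> Cx Cy; rewrite mulrA Cx -mulrA Cy mulrA.
have xC : (qcomm q (k' ^+ 2) C = (q - q^-1) *: (C * k' ^+ 2))
  * (qcomm q (k' * E) C = (q - q^-1) *: (C * (k' * E)))
  * (qcomm q (F * k') C = (q - q^-1) *: (C * (F * k'))).
  by do !split; apply: central; apply: commM.
have Cx : (qcomm q C C = (q - q^-1) *: (C * C))
  * (qcomm q C (k ^+ 2) = (q - q^-1) *: (C * k ^+ 2))
  * (qcomm q C (F * k) = (q - q^-1) *: (C * (F * k)))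
  * (qcomm q C (k * E) = (q - q^-1) *: (C * (k * E))).
  by do !split; apply: qcomm_comm; rewrite ?commM.
have eF := qcomm_kE_Fk rel; have fE := qcomm_Fk_kE rel.
rewrite /P12 /P23 /P123 /P13_conj.
(* From here on C is an opaque atom, known only through its tabulated q-commutators and its
   occurrences in [eF] and [fE]. *)
move: C xC Cx eF fE {CF CE Ck Ck' commM} => c xC Cx eF fE.
rewrite !(qcommDl, qcommDr, qcommZl, qcommZr) !qcommP.
rewrite !(xC, Cx, eF, fE, qcomm_kk_Fk rel, qcomm_kk_kE rel, qcomm_kE_kk rel,
  qcomm_kE_kE rel, qcomm_Fk_kk rel, qcomm_Fk_Fk rel, qcomm_kk_kk rel).
rewrite !(@mulrDr W, =^~ @scalerAr _ W) !PM !mul1r !mulr1.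
rewrite !(P0m, PDl, PDm, PDr, PZl, PZm, PZr).
lin_coefs K; field; by rewrite ?q_neq0 ?q2s_neq0 ?q2D_neq0.
Qed.

End TripleProductIdentity.

(** * Linear maps and the coproducts of the Casimir element *)

Section LinearFun.
Variables (K : pzRingType) (V W : lmodType K) (f : V -> W).
Hypothesis f_lin : linear f.

Lemma linear_funD x y : f (x + y) = f x + f y.
Proof. by have := f_lin 1 x y; rewrite !scale1r. Qed.

Lemma linear_fun0 : f 0 = 0.
Proof. by apply: (addrI (f 0)); rewrite -linear_funD !addr0. Qed.

Lemma linear_funZ c x : f (c *: x) = c *: f x.
Proof. by have := f_lin c x 0; rewrite linear_fun0 !addr0. Qed.

End LinearFun.

Lemma tpureNr (K : fieldType) (V W : lmodType K) (x : V) (y : W) :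
  x ⊗ (- y) = - (x ⊗ y).
Proof. by rewrite -scaleN1r tpureZr scaleN1r. Qed.

Section CasimirCoproducts.
Variables (K : fieldType) (q : K).
Hypotheses (q_neq0 : q != 0) (D_neq0 : q - q^-1 != 0) (s_neq0 : q + q^-1 != 0).

Local Notation U := (Uq q).
Local Notation E := (uE q).
Local Notation F := (uF q).
Local Notation k := (uK q).
Local Notation k' := (uKV q).
Local Notation C := (casimir q).
Local Notation kap := (- ((q - q^-1) ^+ 2 / (q + q^-1))).

Let q2D_neq0 : q * q - 1 != 0.
Proof. by rewrite -(mulfV q_neq0) -mulrBr mulf_neq0. Qed.
Let q2s_neq0 : q * q + 1 != 0.
Proof. by rewrite -(mulfV q_neq0) -mulrDr mulf_neq0. Qed.

Let DeltaD := linear_funD (Delta_linear q_neq0).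
Let DeltaZ := linear_funZ (Delta_linear q_neq0).
Let DeltaM := (Delta_monoid_morphism q_neq0).2.
Let Delta_gens g : Delta (pgen (Urel q) g) = Delta_gen q g.
Proof. exact/plift_gen/Delta_rel. Qed.
Let DeltaE : Delta E = E ⊗ k' + k ⊗ E. Proof. exact: Delta_gens. Qed.
Let DeltaF : Delta F = F ⊗ k' + k ⊗ F. Proof. exact: Delta_gens. Qed.
Let Deltak : Delta k = k ⊗ k. Proof. exact: Delta_gens. Qed.
Let Deltak' : Delta k' = k' ⊗ k'. Proof. exact: Delta_gens. Qed.

(** Expanding Delta(F) Delta(E) gives the mixed terms. The Cartan parts of C ⊗ k'^2 and k^2 ⊗ C
    contain a surplus kap (q + q^-1) / D^2 = -1 times k^2 ⊗ k'^2, which the last term offsets. *)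
Lemma Delta_casimir : Delta C = C ⊗ k' ^+ 2 + k ^+ 2 ⊗ C
  + kap *: ((F * k) ⊗ (k' * E) + (k * E) ⊗ (F * k')) + k ^+ 2 ⊗ k' ^+ 2.
Proof.
rewrite /casimir.
rewrite !(DeltaZ, DeltaD, DeltaM, expr2 k, expr2 k', DeltaE, DeltaF, Deltak,
  Deltak').
rewrite !(mulrDl, mulrDr) !tpureM.
rewrite !(tpureDl, tpureDr, tpureZl, tpureZr).
lin_coefs K; field; by rewrite ?q_neq0 ?q2s_neq0 ?q2D_neq0.
Qed.

Lemma Delta_kk : Delta (k ^+ 2) = k ^+ 2 ⊗ k ^+ 2.
Proof. by rewrite expr2 DeltaM Deltak tpureM. Qed.

Lemma Delta_Fk : Delta (F * k) = (F * k) ⊗ 1 + k ^+ 2 ⊗ (F * k).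
Proof. by rewrite DeltaM Deltak DeltaF mulrDl !tpureM uKVK expr2. Qed.

Lemma Delta_kE : Delta (k * E) = (k * E) ⊗ 1 + k ^+ 2 ⊗ (k * E).
Proof. by rewrite DeltaM Deltak DeltaE mulrDr !tpureM uKKV expr2. Qed.

Let P (x y z : U) : U ⊗ (U ⊗ U) := x ⊗ (y ⊗ z).

Let tassocD := linear_funD (@tassoc_linear K U U U).
Let tassocZ := linear_funZ (@tassoc_linear K U U U).

Let C12E : C12 q = P12 q E F k k' P.
Proof.
rewrite /P12 /P -[qcasimir _ _ _ _ _]/C /C12 Delta_casimir; move: C => c.
by rewrite !(tpureDl, tpureZl) !(tassocD, tassocZ) !tassoc_pure.
Qed.

Let C23E : C23 q = P23 q E F k k' P.
Proof.
rewrite /P23 /P -[qcasimir _ _ _ _ _]/C /C23 Delta_casimir; move: C => c.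
by rewrite !(tpureDr, tpureZr).
Qed.

Let C13_map := fun y : U => (1 : U) ⊗ y.
Let C13_lin : linear C13_map.
Proof. by move=> c x y; rewrite /C13_map tpureDr tpureZr. Qed.
Let id_lin : linear (id : U -> U). Proof. by []. Qed.

Lemma C13E : C13 q = C ⊗ (1 ⊗ k' ^+ 2) + k ^+ 2 ⊗ (1 ⊗ C)
  + kap *: ((F * k) ⊗ (1 ⊗ (k' * E)) + (k * E) ⊗ (1 ⊗ (F * k')))
  + k ^+ 2 ⊗ (1 ⊗ k' ^+ 2).
Proof.
have mapL := tmap_linear id_lin C13_lin.
rewrite /C13 Delta_casimir -/C13_map; move: C => c.
by rewrite !(linear_funD mapL, linear_funZ mapL) !tmap_pure.
Qed.

Let C123E : C123 q = P123 q E F k k' P.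
Proof.
have DL := Delta_linear q_neq0; have mapL := tmap_linear DL id_lin.
rewrite /P123 /P -[qcasimir _ _ _ _ _]/C /C123 Delta_casimir.
rewrite !(linear_funD mapL, linear_funZ mapL) !tmap_pure //.
rewrite Delta_casimir Delta_kk Delta_Fk Delta_kE; move: C => c.
by rewrite !(tpureDl, tpureZl) !(tassocD, tassocZ) !tassoc_pure.
Qed.

Lemma Uq_quantum_sl2 : quantum_sl2 q E F k k'.
Proof.
split=> //; [exact: uKKV|exact: uKVK|exact: uKE|exact: uKF|exact: uEF].
Qed.

Definition C13_conj : U ⊗ (U ⊗ U) := P13_conj q E F k k' P.

(** The identity before completion; it remains to recognize [C13_conj] as the conjugate of C13. *)
Lemma qcomm_C12_C23 : (q - q^-1)^-1 *: qcomm q (C12 q) (C23 q) =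
  C13_conj + (C1 q * C3 q + C2 q * C123 q).
Proof.
rewrite C12E C23E C123E; apply: (qcomm_P12_P23 Uq_quantum_sl2); rewrite /P.
- by move=> x z y y'; rewrite tpureDl tpureDr.
- by move=> c x y z; rewrite tpureZl tpureZr.
- by move=> x y z x' y' z'; rewrite !tpureM.
Qed.

End CasimirCoproducts.

(** * The truncated q-exponential theta and its commutation rules *)

Section QuantumExponential.
Variables (K : fieldType) (q : K).
Hypotheses (q_neq0 : q != 0) (q_not_root : forall n, (0 < n)%N -> q ^+ n != 1).
Local Notation D := (q - q^-1).

Definition theta_coef (j : nat) : K :=
  D ^+ j / qfact q j * q ^+ (j * j.-1)./2.

Let expq_neq0 j : q ^+ j != 0. Proof. exact: expf_neq0. Qed.

(** Otherwise q^(2j+2) = 1. *)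
Lemma qint_num_neq0 j : q ^+ j.+1 - q ^- j.+1 != 0.
Proof.
apply/eqP => /eqP; rewrite subr_eq0 => /eqP e.
have /eqP[] := q_not_root (isT : (0 < j.+1 + j.+1)%N).
by rewrite exprD {1}e mulVf.
Qed.

Lemma subqV_neq0 : D != 0. Proof. exact: qint_num_neq0 0. Qed.

Lemma addqV_neq0 : q + q^-1 != 0.
Proof.
have := qint_num_neq0 1; apply: contra_neq => s0.
have <- : (q + q^-1) * D = q ^+ 2 - q ^- 2 by rewrite mulrC -subr_sqr exprVn.
by rewrite s0 mul0r.
Qed.

Lemma theta_coef0 : theta_coef 0 = 1.
Proof. by rewrite /theta_coef /qfact big_geq // divr1 !mulr1. Qed.

Lemma theta_coefS j : theta_coef j.+1 =
  theta_coef j * D ^+ 2 * q ^+ j / (q ^+ j.+1 - q ^- j.+1).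
Proof.
rewrite /theta_coef /qfact big_nat_recr //=.
(* Triangular numbers are read as binomials, so that Pascal's rule gives the increment j. *)
have -> : (j.+1 * j)./2 = ((j * j.-1)./2 + j)%N.
  by rewrite -[LHS](bin2 j.+1) binS bin1 bin2.
rewrite exprD exprSr {2}/qint !invfM invrK.
have q0 := q_neq0; move: (_ ^+ j.+1 - _) (\prod_(_ <= _ < _) _)^-1 (qint_num_neq0 j).
by move=> n p n0; field; rewrite n0.
Qed.

Section Twist.
Variables (A : algType K) (x : A) (N : nat).
Hypothesis x_nilp : x ^+ N.+1 = 0.

(** The series in [Rtilde] without its factor q^(2 H⊗H), in a form for which [RtildeE] holds by
    conversion. *)
Definition theta : A := \sum_(j < N.+1) theta_coef j *: x ^+ j.

Lemma comm_theta z : z * x = x * z -> z * theta = theta * z.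
Proof.
move=> zx; rewrite mulr_sumr mulr_suml; apply: eq_bigr => j _.
by rewrite -scalerAr -scalerAl; congr (_ *: _); apply: commrX.
Qed.

Lemma skew_exp r z j : z * x = r *: (x * z) -> z * x ^+ j = r ^+ j *: (x ^+ j * z).
Proof.
move=> zx; elim: j => [|j IHj]; first by rewrite !expr0 mulr1 mul1r scale1r.
by rewrite exprS mulrA zx -scalerAl -[x * z * _]mulrA IHj -scalerAr scalerA -exprS mulrA.
Qed.

(** Moving z to the right turns theta(x) into theta(q^-2 x), and theta(q^-2 x) = theta(x) (1 - q^-1
    D^2 x) is the q-difference equation of the q-exponential, read off from [theta_coefS]. *)
Lemma skew_theta z : z * x = q ^- 2 *: (x * z) ->
  z * theta = theta * (1 - (q^-1 * D ^+ 2) *: x) * z.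
Proof.
move=> zx; rewrite mulr_sumr.
under eq_bigr => j _ do rewrite -scalerAr (skew_exp _ zx) scalerA scalerAl.
rewrite -mulr_suml; congr (_ * _).
(* The top term drops out by nilpotency. *)
have theta_x : theta * x = \sum_(j < N) theta_coef j *: x ^+ j.+1.
  rewrite /theta big_ord_recr mulrDl -scalerAl -exprSr x_nilp scaler0 addr0.
  by rewrite mulr_suml; apply: eq_bigr => j _; rewrite -scalerAl -exprSr.
rewrite mulrBr mulr1 -scalerAr theta_x scaler_sumr /theta !big_ord_recl -addrA.
rewrite -sumrB; congr (_ + _); first by rewrite !expr0 mulr1.
apply: eq_bigr => j _; rewrite lift0 scalerA -scalerBl.
congr (_ *: _); rewrite theta_coefS.
have n0 := qint_num_neq0 j.
rewrite exprVn -exprM mulnC exprM; move: n0 (expq_neq0 j.+1) (expq_neq0 j).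
rewrite [q ^+ j.+1]exprS; move: (q ^+ j) (D ^+ 2) => a d n0 qa0 a0.
have n1 : q * a * (q * a) - 1 != 0.
  by rewrite -(mulfV qa0) -mulrBr mulf_neq0.
by field; rewrite q_neq0 a0.
Qed.

Section Shift.
Variables w g g' : A.
Hypotheses (xw : x * w - w * x = D^-1 *: (g - g'))
  (xg : x * g = q ^- 2 *: (g * x)) (g'x : g' * x = q ^- 2 *: (x * g')).

(** This is D^-1 (1 + q^-2 + ... + q^(-2j)), and [theta_coef j.+1 * d j = theta_coef j]. *)
Let d j := (q ^+ j.+1 - q ^- j.+1) / (D ^+ 2 * q ^+ j).

(** The commutator is the sum of x^i [x, w] x^(j-i). Each x that g passes to the left, or g' to the
    right, costs q^-2, which yields the geometric sum [d j]. *)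
Let shift_exp j : x ^+ j.+1 * w - w * x ^+ j.+1 = d j *: (g * x ^+ j - x ^+ j * g').
Proof.
elim: j => [|j IHj].
  rewrite !expr1 !expr0 mulr1 mul1r xw /d expr1 expr0 mulr1; congr (_ *: _).
  by have D0 := subqV_neq0; move: D D0 => D D0; field.
have -> : x ^+ j.+2 * w - w * x ^+ j.+2 =
    x * (x ^+ j.+1 * w - w * x ^+ j.+1) + (x * w - w * x) * x ^+ j.+1.
  by rewrite mulrBr mulrBl [x ^+ j.+2]exprS !mulrA addrA subrK.
have xxj : x * x ^+ j = x ^+ j.+1 by rewrite exprS.
rewrite IHj xw -scalerAr -scalerAl mulrBr mulrBl !mulrA xg xxj.
rewrite (skew_exp _ g'x) -scalerAl -[g * x * _]mulrA xxj.
rewrite exprVn -exprM mulnC exprM /d; have n0 := qint_num_neq0 j.+1.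
move: (expq_neq0 j) subqV_neq0 q_neq0; rewrite ![q ^+ _.+1]exprS.
move: (g * _) (_ * g') (q ^+ j) => u v a a0 D0 q0.
have q2_neq0 : q * q - 1 != 0 by rewrite -(mulfV q0) -mulrBr mulf_neq0.
by lin_coefs K; field; rewrite ?q0 ?a0 ?q2_neq0.
Qed.

(** Summing [shift_exp] with weights [theta_coef j.+1] reproduces theta, since [d j] is the inverse
    ratio of consecutive coefficients. *)
Lemma shift_theta : w * theta = theta * w + theta * g' - g * theta.
Proof.
(* The sum of commutators stops at j = N - 1, so the term j = N of g theta - theta g' must vanish;
   it does by [shift_exp N], as x^(N+1) = 0. *)
have top0 : g * x ^+ N - x ^+ N * g' = 0.
  have := shift_exp N; rewrite x_nilp mul0r mulr0 subrr => /esym/eqP.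
  rewrite scaler_eq0 => /orP[|/eqP//]; rewrite /d mulf_eq0 invr_eq0 mulf_eq0.
  by rewrite (negPf (qint_num_neq0 N)) expf_eq0 /= (negPf subqV_neq0) (negPf (expq_neq0 N)).
have gtheta : g * theta - theta * g' =
    \sum_(j < N) theta_coef j *: (g * x ^+ j - x ^+ j * g').
  rewrite /theta big_ord_recr /= mulrDr mulrDl opprD addrACA.
  rewrite -scalerAr -scalerAl -scalerBr top0 scaler0 addr0.
  rewrite mulr_suml mulr_sumr -sumrB; apply: eq_bigr => j _.
  by rewrite -scalerAr -scalerAl -scalerBr.
have key : theta * w - w * theta = g * theta - theta * g'.
  rewrite gtheta /theta big_ord_recl theta_coef0 expr0 scale1r.
  rewrite mulrDl mulrDr mul1r mulr1 opprD addrACA subrr add0r.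
  rewrite mulr_suml mulr_sumr -sumrB; apply: eq_bigr => j _.
  rewrite -scalerAr -scalerAl -scalerBr lift0 shift_exp.
  rewrite scalerA; congr (_ *: _); rewrite theta_coefS /d.
  have := qint_num_neq0 j; have := subqV_neq0; have := expq_neq0 j.
  move: (q ^+ j.+1 - _) D (q ^+ j) => m D a a0 D0 m0.
  by field; rewrite a0 D0 m0.
apply: (addrI (- (g * theta) - w * theta)).
have -> : - (g * theta) - w * theta + w * theta = - (g * theta).
  by rewrite subrK.
have -> : - (g * theta) - w * theta + (theta * w + theta * g' - g * theta) =
    - (g * theta) + (theta * w - w * theta - (g * theta - theta * g')).
  by lin_coefs K; ring.
by rewrite key subrr addr0.
Qed.

(** With u = 1 - q^-1 D^2 x, the term of [shift_theta] that has g on the left becomes g theta u z =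
    g z theta = theta a. *)
Lemma shift_conj_theta z a : z * x = q ^- 2 *: (x * z) -> g * z = a ->
  a * x = x * a ->
  (w * z) * theta = theta * ((w + g') * (1 - (q^-1 * D ^+ 2) *: x) * z - a).
Proof.
move=> zx gz ax; have := skew_theta zx; move: (1 - _) => u ztheta.
have atheta := comm_theta ax; rewrite -gz in atheta *.
rewrite -mulrA ztheta !mulrA shift_theta mulrBr -[theta * (g * z)]atheta.
by rewrite -[g * z * _]mulrA ztheta !mulrA !(mulrBl, mulrDl, mulrDr) ?mulrA.
Qed.

End Shift.
End Twist.
End QuantumExponential.

(** * Conjugation by the R-matrix on a product of two simple modules *)

Section RConjugation.
Variables (K : fieldType) (q qh : K) (n1 n2 : nat).
Hypotheses (q_neq0 : q != 0) (q_not_root : forall n, (0 < n)%N -> q ^+ n != 1)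
  (qhE : qh ^+ 2 = q).

Local Notation U := (Uq q).
Local Notation E := (uE q).
Local Notation F := (uF q).
Local Notation k := (uK q).
Local Notation k' := (uKV q).
Local Notation C := (casimir q).
Local Notation D := (q - q^-1).

(** The size is a visible successor, as the algebra structure on matrices requires; it is
    convertible with [n1.+1 * n2.+1]. *)
Let A : algType K := 'M[K]_((n1.+1 * n2.+1).-1.+1).
Let rho : U ⊗ U -> A := rep2 qh n1 n2.

Let rhoD : {morph rho : x y / x + y}.
Proof. exact/linear_funD/rep2_linear. Qed.
Let rhoZ c x : rho (c *: x) = c *: rho x.
Proof. exact/linear_funZ/rep2_linear. Qed.
Let rhoB : {morph rho : x y / x - y}.
Proof. by move=> x y; rewrite -scaleN1r rhoD rhoZ scaleN1r. Qed.
Let rhoM : {morph rho : x y / x * y}.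
Proof. exact: (rep2_monoid_morphism q_neq0 qhE n1 n2).2. Qed.
Let rho1 : rho 1 = 1.
Proof. exact: (rep2_monoid_morphism q_neq0 qhE n1 n2).1. Qed.

Let x : U ⊗ U := (F * k) ⊗ (k' * E).
Let N := minn n1 n2.
Let th : A := theta q (rho x) N.
Let Q : A := q2HH qh (n1, n2).

Let x_nilp : rho x ^+ N.+1 = 0.
Proof. exact: (@Rseries_nilp _ q qh q_neq0 qhE n1 n2 N.+1). Qed.

Let RtildeE : Rtilde q qh (n1, n2) = th * Q.
Proof. by []. Qed.

Let qh_neq0 : qh != 0.
Proof. by move: q_neq0; rewrite -qhE expf_eq0. Qed.

Let wtS n i : wt n i.+1 = wt n i - 2.
Proof. by rewrite /wt doubleS -addn2 PoszD opprD addrA. Qed.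

(** z acts as Q^-1 y Q, stated without an inverse; the relation is compatible with sums and
    products. *)
Definition Qconj (y z : U ⊗ U) : Prop := rho y * Q = Q * rho z.

Lemma QconjM y z y' z' : Qconj y z -> Qconj y' z' -> Qconj (y * y') (z * z').
Proof. by rewrite /Qconj !rhoM => yz yz'; rewrite -mulrA yz' !mulrA yz. Qed.
Lemma QconjD y z y' z' : Qconj y z -> Qconj y' z' -> Qconj (y + y') (z + z').
Proof. by rewrite /Qconj !rhoD mulrDl mulrDr => -> ->. Qed.
Lemma QconjZ c y z : Qconj y z -> Qconj (c *: y) (c *: z).
Proof. by rewrite /Qconj !rhoZ -scalerAl -scalerAr => ->. Qed.

Lemma QconjB y z y' z' : Qconj y z -> Qconj y' z' -> Qconj (y - y') (z - z').
Proof.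
move=> yz yz'; rewrite -(scaleN1r y') -(scaleN1r z').
exact: QconjD yz (QconjZ (-1) yz').
Qed.

Let rep_gens n g : rep qh n (pgen (Urel q) g) = V_gen q qh n g.
Proof. exact/plift_gen/V_rel. Qed.
Let rep_one n : rep qh n (1 : U) = 1%:M.
Proof. exact: (rep_monoid_morphism q_neq0 qhE n).1. Qed.
Let rep_mul n (y z : U) : rep qh n (y * z) = rep qh n y *m rep qh n z.
Proof. exact: (rep_monoid_morphism q_neq0 qhE n).2. Qed.

Let Qconj_pure (y1 y2 z1 z2 : U) :
  (forall i1 i2 j1 j2, rep qh n1 y1 i1 j1 * rep qh n2 y2 i2 j2 *
      qh ^ (wt n1 j1 * wt n2 j2) =
    qh ^ (wt n1 i1 * wt n2 i2) * (rep qh n1 z1 i1 j1 * rep qh n2 z2 i2 j2)) ->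
  Qconj (y1 ⊗ y2) (z1 ⊗ z2).
Proof.
move=> yz; rewrite /Qconj /rho !rep2_pure //.
rewrite -[LHS]/(_ *m diag_mx _) -[RHS]/(diag_mx _ *m _) mul_mx_diag mul_diag_mx.
by apply/matrixP => i j; rewrite !mxE yz.
Qed.

Let rep_kk n : rep qh n (k ^+ 2) = diag_mx (\row_i qh ^ (2 * wt n i)).
Proof.
rewrite expr2 rep_mul rep_gens mulmx_diag; congr diag_mx; apply/rowP => i.
by rewrite !mxE -expfzDr //; congr (_ ^ _); ring.
Qed.
Let rep_k'k' n : rep qh n (k' ^+ 2) = diag_mx (\row_i qh ^ (- (2 * wt n i))).
Proof.
rewrite expr2 rep_mul rep_gens mulmx_diag; congr diag_mx; apply/rowP => i.
by rewrite !mxE -expfzDr //; congr (_ ^ _); ring.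
Qed.

Let expand := (mul0r, mulr0, mulr0n, mulr1n, mul1r, mulr1, wtS).

(** F lowers the doubled weight of the first factor by 2, which changes the eigenvalue of Q by a
    power of [qh] that k^2 on the second factor restores. *)
Lemma Qconj_F1 : Qconj (F ⊗ 1) (F ⊗ k ^+ 2).
Proof.
apply: Qconj_pure => i1 i2 j1 j2; rewrite rep_kk rep_one rep_gens !mxE.
case: eqP => [->|_]; case: eqP => [->|_]; rewrite ?expand //.
by rewrite -expfzDr //; congr (_ ^ _); ring.
Qed.

Lemma Qconj_1F : Qconj (1 ⊗ F) (k ^+ 2 ⊗ F).
Proof.
apply: Qconj_pure => i1 i2 j1 j2; rewrite rep_kk rep_one rep_gens !mxE.
case: eqP => [->|_]; case: eqP => [->|_]; rewrite ?expand //.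
by rewrite -expfzDr //; congr (_ ^ _); ring.
Qed.

Lemma Qconj_1E : Qconj (1 ⊗ E) (k' ^+ 2 ⊗ E).
Proof.
apply: Qconj_pure => i1 i2 j1 j2; rewrite rep_k'k' rep_one rep_gens !mxE.
case: eqP => [->|_]; case: eqP => [->|_]; rewrite ?expand //.
by rewrite mulrC [RHS]mulrA -expfzDr //; congr (_ ^ _ * _); ring.
Qed.

Lemma Qconj_diag1 y (d : 'rV[K]_n1.+1) :
  rep qh n1 y = diag_mx d -> Qconj (y ⊗ 1) (y ⊗ 1).
Proof.
move=> yd; apply: Qconj_pure => i1 i2 j1 j2; rewrite yd rep_one !mxE.
by case: eqP => [->|_]; case: eqP => [->|_]; rewrite ?expand // mulrC.
Qed.

Lemma Qconj_1diag y (d : 'rV[K]_n2.+1) :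
  rep qh n2 y = diag_mx d -> Qconj (1 ⊗ y) (1 ⊗ y).
Proof.
move=> yd; apply: Qconj_pure => i1 i2 j1 j2; rewrite yd rep_one !mxE.
by case: eqP => [->|_]; case: eqP => [->|_]; rewrite ?expand // mulrC.
Qed.

Lemma Qconj_k1 : Qconj (k ⊗ 1) (k ⊗ 1).
Proof. exact: Qconj_diag1 (rep_gens n1 GK). Qed.
Lemma Qconj_k'1 : Qconj (k' ⊗ 1) (k' ⊗ 1).
Proof. exact: Qconj_diag1 (rep_gens n1 GKV). Qed.
Lemma Qconj_1k : Qconj (1 ⊗ k) (1 ⊗ k).
Proof. exact: Qconj_1diag (rep_gens n2 GK). Qed.
Lemma Qconj_1k' : Qconj (1 ⊗ k') (1 ⊗ k').
Proof. exact: Qconj_1diag (rep_gens n2 GKV). Qed.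

Let rel : quantum_sl2 q E F k k'.
Proof.
exact: Uq_quantum_sl2 q_neq0 (subqV_neq0 q_neq0 q_not_root)
  (addqV_neq0 q_neq0 q_not_root).
Qed.

Let Pmap : pair_map (fun y z : U => y ⊗ z : U ⊗ U) := tpure_pair_map _.

Definition Rconj (y z : U ⊗ U) : Prop :=
  rho y * (Rtilde q qh (n1, n2) : A) = (Rtilde q qh (n1, n2) : A) * rho z.

(** The R-matrix is passed in two stages, first theta and then Q. *)
Let RconjQ y m z : rho y * th = th * rho m -> Qconj m z -> Rconj y z.
Proof. by rewrite /Rconj RtildeE => ym mz; rewrite mulrA ym -!mulrA mz. Qed.

Let Qconj_1 : Qconj 1 1.
Proof. by rewrite /Qconj rho1 mul1r mulr1. Qed.

Let Qconj_x : Qconj x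
  ((F ⊗ k ^+ 2) * (k ⊗ 1) * (1 ⊗ k') * (k' ^+ 2 ⊗ E)).
Proof.
have -> : x = (F ⊗ 1) * (k ⊗ 1) * (1 ⊗ k') * (1 ⊗ E).
  by rewrite !tpureM !mulr1 !mul1r.
exact: QconjM (QconjM (QconjM Qconj_F1 Qconj_k1) Qconj_1k') Qconj_1E.
Qed.

Let Qconj_u : Qconj (1 - (q^-1 * D ^+ 2) *: x) (1 - (q^-1 * D ^+ 2) *:
  ((F ⊗ k ^+ 2) * (k ⊗ 1) * (1 ⊗ k') * (k' ^+ 2 ⊗ E))).
Proof. exact: QconjB Qconj_1 (QconjZ _ Qconj_x). Qed.

Let skew_rho z y v w c : z * y = c *: (v * w) ->
  rho z * rho y = c *: (rho v * rho w).
Proof. by rewrite -!rhoM -rhoZ => ->. Qed.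

Let rho_u : 1 - (q^-1 * D ^+ 2) *: rho x = rho (1 - (q^-1 * D ^+ 2) *: x).
Proof. by rewrite rhoB rho1 rhoZ. Qed.

Lemma Rconj_k'k' : Rconj (1 ⊗ k' ^+ 2)
  (1 ⊗ k' ^+ 2 - (q * D ^+ 2) *: ((F * k') ⊗ (k' * E))).
Proof.
rewrite -(pair_conj_k'k' rel Pmap).
apply: RconjQ; last exact: QconjM Qconj_u (QconjM Qconj_1k' Qconj_1k').
have zx := skew_rho (pair_skew_k'k' rel Pmap).
rewrite (skew_theta q_neq0 q_not_root x_nilp zx) rho_u -mulrA -rhoM.
by rewrite tpureM mulr1 -expr2.
Qed.

Lemma Rconj_k'E : Rconj (1 ⊗ (k' * E)) (k' ^+ 2 ⊗ (k' * E)).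
Proof.
have -> : k' ^+ 2 ⊗ (k' * E) = (1 ⊗ k') * (k' ^+ 2 ⊗ E) by rewrite tpureM mul1r.
apply: RconjQ; last exact: QconjM Qconj_1k' Qconj_1E.
rewrite tpureM mulr1; apply: comm_theta.
by rewrite -!rhoM (pair_comm_k'E rel Pmap).
Qed.

Lemma Rconj_casimir : Rconj (1 ⊗ C) (1 ⊗ C).
Proof.
have Cx : rho (1 ⊗ C) * rho x = rho x * rho (1 ⊗ C).
  by rewrite -!rhoM; congr rho; exact: (pair_comm_casimir rel Pmap).
apply: RconjQ; first exact: comm_theta Cx.
rewrite -[X in Qconj _ X](pair_conj_casimir rel Pmap).
have -> : 1 ⊗ C = (- (D ^+ 2 / (q + q^-1))) *: ((1 ⊗ F) * (1 ⊗ E)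
    + (D ^+ 2)^-1 *: (q *: ((1 ⊗ k) * (1 ⊗ k)) + q^-1 *: ((1 ⊗ k') * (1 ⊗ k'))))
    :> U ⊗ U.
  by rewrite /casimir !tpureM mulr1 !expr2 !(tpureZr, tpureDr).
apply/QconjZ/QconjD; first exact: QconjM Qconj_1F Qconj_1E.
apply/QconjZ/QconjD; apply/QconjZ.
  exact: QconjM Qconj_1k Qconj_1k.
exact: QconjM Qconj_1k' Qconj_1k'.
Qed.

Lemma Rconj_Fk' : Rconj (1 ⊗ (F * k')) (k ^+ 2 ⊗ (F * k')
  + ((q + q^-1) / q) *: ((F * k) ⊗ k' ^+ 2 + (F * k) ⊗ C)
  - D ^+ 2 *: (F ^+ 2 ⊗ (k' * E))).
Proof.
rewrite -(pair_conj_Fk' rel Pmap).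
(* [m] below is the element that [shift_conj_theta] yields. Its part w + g', here named [w], is
   factored into elements with known Q-conjugates. *)
pose w := (k' ⊗ 1) * (1 ⊗ F) + (F ⊗ 1) * ((1 ⊗ k') * (1 ⊗ k') * (1 ⊗ k')).
pose m := w * (1 - (q^-1 * D ^+ 2) *: x) * ((k ⊗ 1) * (1 ⊗ k'))
  - (F ⊗ 1) * (k ⊗ 1).
apply: (@RconjQ _ m); last first.
  apply: QconjB (QconjM Qconj_F1 Qconj_k1).
  apply: QconjM (QconjM Qconj_k1 Qconj_1k'); apply: QconjM Qconj_u.
  apply: QconjD; first exact: QconjM Qconj_k'1 Qconj_1F.
  exact: QconjM Qconj_F1 (QconjM (QconjM Qconj_1k' Qconj_1k') Qconj_1k').
have xw : rho x * rho (k' ⊗ F) - rho (k' ⊗ F) * rho x =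
    D^-1 *: (rho (F ⊗ k) - rho (F ⊗ k' ^+ 3)).
  by have := congr1 rho (pair_shift rel Pmap); rewrite rhoZ !rhoB !rhoM.
have gz : rho (F ⊗ k) * rho (k ⊗ k') = rho ((F * k) ⊗ 1).
  by rewrite -rhoM tpureM uKKV.
have ax : rho ((F * k) ⊗ 1) * rho x = rho x * rho ((F * k) ⊗ 1).
  by rewrite -!rhoM (pair_comm_Fk rel Pmap).
have := shift_conj_theta q_neq0 q_not_root x_nilp xw
  (skew_rho (pair_skew_Fk rel Pmap)) (skew_rho (pair_skew_Fk' rel Pmap))
  (skew_rho (pair_skew_kk' rel Pmap)) gz ax.
have -> : 1 ⊗ (F * k') = (k' ⊗ F) * (k ⊗ k') :> U ⊗ U by rewrite tpureM uKVK.
have -> : m = (k' ⊗ F + F ⊗ k' ^+ 3) * (1 - (q^-1 * D ^+ 2) *: x) * (k ⊗ k')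
    - (F * k) ⊗ 1.
  have wE : w = k' ⊗ F + F ⊗ k' ^+ 3.
    by rewrite /w !tpureM !mulr1 !mul1r -mulrA.
  by rewrite /m wE [(k ⊗ 1) * _]tpureM [(F ⊗ 1) * _]tpureM !mulr1 mul1r.
by rewrite rho_u -!rhoM -rhoD -!rhoM -rhoB.
Qed.

End RConjugation.

(** * The conjugate of C13 in the completed triple tensor product *)

Section C13Conjugation.
Variables (K : fieldType) (q qh : K).
Hypotheses (q_neq0 : q != 0) (q_not_root : forall n, (0 < n)%N -> q ^+ n != 1)
  (qhE : qh ^+ 2 = q).

Local Notation U := (Uq q).
Local Notation E := (uE q).
Local Notation F := (uF q).
Local Notation k := (uK q).
Local Notation k' := (uKV q).
Local Notation C := (casimir q).
Local Notation D := (q - q^-1).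

Let D_neq0 := subqV_neq0 q_neq0 q_not_root.
Let s_neq0 := addqV_neq0 q_neq0 q_not_root.

(** Grouped as in [C13E]: each inner factor is the R-conjugate of the corresponding inner factor of
    C13. *)
Let C13_conjE : C13_conj q =
  C ⊗ (1 ⊗ k' ^+ 2 - (q * D ^+ 2) *: ((F * k') ⊗ (k' * E)))
  + k ^+ 2 ⊗ (1 ⊗ C)
  + (- (D ^+ 2 / (q + q^-1))) *: ((F * k) ⊗ (k' ^+ 2 ⊗ (k' * E))
    + (k * E) ⊗ (k ^+ 2 ⊗ (F * k')
        + ((q + q^-1) / q) *: ((F * k) ⊗ k' ^+ 2 + (F * k) ⊗ C)
        - D ^+ 2 *: (F ^+ 2 ⊗ (k' * E))))
  + k ^+ 2 ⊗ (1 ⊗ k' ^+ 2 - (q * D ^+ 2) *: ((F * k') ⊗ (k' * E))).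
Proof.
rewrite /C13_conj /P13_conj -[qcasimir _ _ _ _ _]/C; move: C => c.
rewrite !(tpureDr, tpureNr, tpureZr).
by lin_coefs K; ring.
Qed.

Let R3conj (n : nat * (nat * nat)) (y z : U ⊗ (U ⊗ U)) : Prop :=
  rep3 qh n.1 n.2.1 n.2.2 y *m Rtilde23 q qh n =
  Rtilde23 q qh n *m rep3 qh n.1 n.2.1 n.2.2 z.

Let R3conjD n y z y' z' : R3conj n y z -> R3conj n y' z' ->
  R3conj n (y + y') (z + z').
Proof.
rewrite /R3conj !(linear_funD (rep3_linear q_neq0 qhE _ _ _)).
by rewrite mulmxDl mulmxDr => -> ->.
Qed.

Let R3conjZ n c y z : R3conj n y z -> R3conj n (c *: y) (c *: z).
Proof.
rewrite /R3conj !(linear_funZ (rep3_linear q_neq0 qhE _ _ _)).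
by rewrite -scalemxAl -scalemxAr => ->.
Qed.

(** [Rtilde23] is the identity on the first factor, so [a] passes through it. *)
Let R3conj_pure n (a : U) y z : Rconj qh n.2.1 n.2.2 y z ->
  R3conj n (a ⊗ y) (a ⊗ z).
Proof.
case: n => n1 [n2 n3] /= yz; rewrite /R3conj /Rtilde23 /= !rep3_pure //.
by rewrite !tensmx_mul mulmx1 mul1mx; congr (_ *t _).
Qed.

Lemma C13_Rtilde : C13_0 q qh = embed3 qh (C13_conj q).
Proof.
apply/prodringP => n; rewrite /C13_0 !prodringM.
rewrite -[LHS]mulrA.
have -> : embed3 qh (C13 q) n * Rtilde23 q qh n =
    Rtilde23 q qh n * embed3 qh (C13_conj q) n.
  rewrite -/(R3conj n _ _) C13E // C13_conjE.
  apply: R3conjD; last exact/R3conj_pure/Rconj_k'k'.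
  apply: R3conjD; last first.
    apply/R3conjZ/R3conjD; apply: R3conj_pure; first exact: Rconj_k'E.
    exact: Rconj_Fk'.
  apply: R3conjD; apply: R3conj_pure; first exact: Rconj_k'k'.
  exact: Rconj_casimir.
rewrite mulrA -[X in X * _]/((Rtilde23V q qh * Rtilde23 q qh) n).
by rewrite (Rtilde23V_inverse q_neq0 qhE).2 prodring1 mul1r.
Qed.

Lemma embed3_qcomm_C12_C23 :
  embed3 qh (D^-1 *: qcomm q (C12 q) (C23 q)) =
  C13_0 q qh + embed3 qh (C1 q * C3 q + C2 q * C123 q).
Proof.
rewrite C13_Rtilde qcomm_C12_C23 //; apply/prodringP => n.
by rewrite prodringD /embed3 (linear_funD (rep3_linear q_neq0 qhE _ _ _)).
Qed.

End C13Conjugation.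

Theorem proposition4p1 (R : realType) (q qh : R[i])
    (q_neq0 : q != 0)
    (q_not_root : forall n : nat, (0 < n)%N -> q ^+ n != 1)
    (qhE : qh ^+ 2 = q) :
  embed3 qh ((q - q^-1)^-1 *: qcomm q (C12 q) (C23 q))
  = C13_0 q qh + embed3 qh (C1 q * C3 q + C2 q * C123 q).
Proof. exact: embed3_qcomm_C12_C23. Qed.
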